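(* For each integer $n\ge 1$, let $Z_n=Z_n(\lambda,c)=h(\lambda,c)$ be the hook length of the cell $c$ in the Young diagram of $\lambda$, where the pair $(\lambda,c)$ is random: $\lambda$ is a partition of $n$, $c$ is a cell of the Young diagram of $\lambda$, and each such pair has probability $\mathbb{P}((\lambda,c))=\frac{1}{n\,p(n)}$, with $p(n)$ the number of partitions of $n$. Then, for every real $y$ with $0<y<\infty$, $$ \lim_{n\to\infty}\mathbb{P}\left(\frac{\pi Z_n}{\sqrt{6n}}\le y\right)=\frac{6}{\pi^2}\int_0^y\frac{u}{e^u-1}\,du . $$
   Context: A partition of a positive integer $n$ is a sequence $\lambda=(\lambda_1,\lambda_2,\dots,\lambda_k)$ of positive integers with $\lambda_1\ge\lambda_2\ge\dots\ge\lambda_k$ and $\sum_{j=1}^k\lambda_j=n$. Let $\Lambda(n)$ be the set of all partitions of $n$ and $p(n)=|\Lambda(n)|$. The Young diagram of $\lambda$ is the left-justified array of $n$ cells with $\lambda_t$ cells in the $t$-th row; its cells are labelled $(t,s)$ with $1\le t\le k$ (row number) and $1\le s\le\lambda_t$ (column number). The conjugate partition $\lambda^*=(\lambda_1^*,\dots,\lambda_l^* )$, $l=\lambda_1$, is given by letting $\lambda_s^*$ be the number of cells in the $s$-th column, i.e. $\lambda_s^*=|\{t:\lambda_t\ge s\}|$. The hook length of the cell $c=(t,s)$ in $\lambda$ is $$h(\lambda,c)=\lambda_t-s+\lambda_s^*-t+1 .$$ The sample space is $\Omega(n)=\{(\lambda,c):\lambda\in\Lambda(n),\ c \text{ a cell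 of the Young diagram of }\lambda\}$, which has $n\,p(n)$ elements, and $\mathbb{P}$ is the uniform probability measure on it (equivalently: choose $\lambda\in\Lambda(n)$ uniformly at random, then choose one of the $n$ cells of its Young diagram uniformly at random). *)

(* Defs.v *)
From HB Require Import structures.
From mathcomp Require Import all_boot all_order all_algebra.
From mathcomp Require Import all_classical all_reals all_analysis.

Set Implicit Arguments.
Unset Strict Implicit.
Unset Printing Implicit Defensive.

Import Order.TTheory GRing.Theory Num.Theory.
Import numFieldNormedType.Exports.

Definition is_partition (n : nat) (s : seq nat) : bool :=
  [&& sorted geq s, 0 \notin s & sumn s == n].

Record partition_of (n : nat) : Type :=
  PartitionOf { parts :> seq nat; _ : is_partition n parts }.

HB.instance Definition _ n := [isSub for @parts n].
HB.instance Definition _ n := [Countable of partition_of n by <:].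

(* A partition of n has at most n parts, each at most n: this gives an
   injection into a finite type, from which finiteness is derived. *)
Section PartitionFinite.
Variable n : nat.

Definition partition_encode (p : partition_of n) : n.-bseq 'I_n.+1 :=
  insub_bseq n (map inord (parts p)).

Definition partition_decode (b : n.-bseq 'I_n.+1) : option (partition_of n) :=
  insub (map val b).

Lemma size_le_sumn (s : seq nat) : 0 \notin s -> size s <= sumn s.
Proof.
elim: s => //= x s IHs; rewrite inE negb_or => /andP[x0 /IHs le_s].
by rewrite -add1n leq_add // lt0n eq_sym.
Qed.

Lemma mem_le_sumn (s : seq nat) x : x \in s -> x <= sumn s.
Proof.
elim: s => //= a s IHs; rewrite inE => /orP[/eqP->|/IHs le_s].
  exact: leq_addr.
exact: leq_trans le_s (leq_addl _ _).
Qed.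

Lemma partition_encodeK : pcancel partition_encode partition_decode.
Proof.
case=> s sP; rewrite /partition_encode /partition_decode /=.
have /and3P[_ s0 /eqP sn] := sP.
have sz : size (map (@inord n) s) <= n by rewrite size_map -sn size_le_sumn.
rewrite /insub_bseq insubdK // -map_comp (_ : map _ s = s).
  by rewrite insubT; congr Some; apply: val_inj.
rewrite -[RHS]map_id; apply/eq_in_map => x xs /=.
by rewrite inordK // ltnS -sn mem_le_sumn.
Qed.

HB.instance Definition _ :=
  fintype.isFinite.Build (partition_of n) (pcan_enumP partition_encodeK).

End PartitionFinite.

(* p(n) *)
Definition npartitions (n : nat) : nat := #|{: partition_of n}|.

(* Rows and columns are numbered from 1, as in the usual labelling (t, s). *)
Definition row_len (l : seq nat) (t : nat) : nat := nth 0 l t.-1.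

Definition col_len (l : seq nat) (s : nat) : nat := count (leq s) l.

Definition cells (l : seq nat) : seq (nat * nat) :=
  [seq (t, s) | t <- iota 1 (size l), s <- iota 1 (row_len l t)].

(* The subtractions are truncated, but for a cell c = (t, s) of the diagram of
   a partition l one has s <= row_len l t and t <= col_len l s, so no
   truncation occurs (see hook_lengthE). *)
Definition hook_length (l : seq nat) (c : nat * nat) : nat :=
  let: (t, s) := c in row_len l t - s + col_len l s - t + 1.

Definition Omega (n : nat) : finType :=
  {l : partition_of n & seq_sub (cells l)}.

Definition Z (n : nat) (w : Omega n) : nat :=
  hook_length (tag w) (val (tagged w)).

Definition Pr (R : realType) (n : nat) (A : pred (Omega n)) : R :=
  (\sum_(w : Omega n | A w) ((n * npartitions n)%:R)^-1)%R.

Lemma mem_cells (l : seq nat) (t s : nat) :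
  ((t, s) \in cells l) = (0 < t <= size l) && (0 < s <= row_len l t).
Proof.
apply/allpairsPdep/andP => [[t' [s' []]]|[tl sl]].
  by rewrite !mem_iota !add1n !ltnS => tl sl [-> ->].
by exists t, s; rewrite !mem_iota !add1n !ltnS.
Qed.

Lemma cells_uniq (l : seq nat) : uniq (cells l).
Proof.
apply: allpairs_uniq_dep; rewrite ?iota_uniq //.
  by move=> t _; exact: iota_uniq.
by move=> [a b] [c d] _ _ /= [-> ->].
Qed.

Lemma size_cells (l : seq nat) : size (cells l) = sumn l.
Proof.
rewrite size_allpairs_dep; congr sumn.
rewrite (eq_map (fun t => size_iota 1 (row_len l t))).
rewrite -[RHS](mkseq_nth 0) /mkseq -(addn0 1) iotaDl -map_comp.
by apply: eq_map.
Qed.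

Lemma leq_col_len (l : seq nat) (t s : nat) :
  sorted geq l -> (t, s) \in cells l -> t <= col_len l s.
Proof.
move=> l_sorted; rewrite mem_cells => /andP[/andP[t0 tl] /andP[_ sl]].
rewrite /col_len -(cat_take_drop t l) count_cat.
apply: leq_trans (leq_addr _ _); rewrite -{1}(size_takel tl).
suff : all (leq s) (take t l) by rewrite all_count => /eqP->.
apply/(all_nthP 0) => i; rewrite (size_takel tl) => it.
rewrite nth_take //; apply: leq_trans sl _.
have geqT : transitive geq by move=> y x z /= yx zy; exact: leq_trans zy yx.
apply: (sorted_leq_nth geqT) => //; rewrite ?inE.
- exact: leqnn.
- exact: leq_trans it tl.
- by rewrite prednK.
- by rewrite -ltnS prednK.
Qed.

Lemma hook_lengthE (n : nat) (l : partition_of n) (t s : nat) :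
  (t, s) \in cells l ->
  ((hook_length l (t, s))%:Z =
     (row_len l t)%:Z - s%:Z + (col_len l s)%:Z - t%:Z + 1)%R.
Proof.
case: l => l /= /and3P[l_sorted _ _] lts.
have tl := leq_col_len l_sorted lts.
move: lts; rewrite mem_cells => /and3P[_ _ sl].
by rewrite PoszD -subzn ?PoszD ?subzn // (leq_trans tl) // leq_addl.
Qed.

Lemma card_Omega (n : nat) : #|Omega n| = n * npartitions n.
Proof.
rewrite card_tagged sumnE big_map big_enum /=.
rewrite (eq_bigr (fun=> n)) ?sum_nat_const 1?mulnC // => l _.
rewrite card_seq_sub ?cells_uniq // size_cells.
by case: l => l /= /and3P[_ _ /eqP].
Qed.

Lemma npartitions_gt0 (n : nat) : 0 < n -> 0 < npartitions n.
Proof.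
move=> n0; have nP : is_partition n [:: n].
  by rewrite /is_partition /= inE addn0 eqxx andbT eq_sym -lt0n.
by apply/card_gt0P; exists (PartitionOf nP).
Qed.

Lemma Pr_predT (R : realType) (n : nat) :
  0 < n -> Pr R (predT : pred (Omega n)) = 1%R.
Proof.
move=> n0; rewrite /Pr sumr_const card_Omega -[LHS]mulr_natl divff //.
by rewrite pnatr_eq0 muln_eq0 negb_or -!lt0n n0 npartitions_gt0.
Qed.

(* Main.v *)
(** Moving a bead from [b] to [b + k] in the set of beta-numbers of a partition
    of [n] adds a rim hook of length [k]; a partition has exactly [k] more ways
    to add such a hook than to remove one.  Hence the number of cells with hook
    length [k] in all partitions of [n] is [\sum_(j >= 1) k p(n - j k)], and
    [n p(n)] is the sum of these numbers over [k].

    Put [q(n) = \sum_v v p(n - v)].  As [p] is nondecreasing,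
    [\sum_k k p(n - j k)] is [q(n) / j^2] up to an error [P(n) / j], with
    [P(n) = \sum_(i <= n) p(i)], so [n p(n) / q(n)] tends to [pi^2 / 6] by
    dominated convergence.  The ratio [V(n) = q(n + 1) / P(n)] satisfies the
    discrete Riccati recursion [V(n) = 1 + V(n - 1) / (1 + V(n - 1) p(n) / q(n))],
    whence [V(n) ~ sqrt n / c] with [c = pi / sqrt 6] and
    [q(n - x sqrt n) / q(n) -> exp (- c x)].  No asymptotic formula for [p] is
    needed: the truncated sum over [k <= K] differs from the full one by sums of
    the same kind at [n - j K], so with [K ~ (y / c) sqrt n] it is asymptotic to
    [q(n) (1 - (1 + j y) exp (- j y)) / j^2], and this is [q(n)] times
    [\int_0^y u exp (- j u) du]. *)
Require Import Defs.
From mathcomp Require Import all_boot all_order all_algebra.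
From mathcomp Require Import all_classical all_reals all_analysis.
From mathcomp Require Import measurable_realfun zify ring lra.

Import Order.TTheory GRing.Theory Num.Theory.
Import numFieldNormedType.Exports.
Set Implicit Arguments.
Unset Strict Implicit.
Unset Printing Implicit Defensive.

(** * Beta-sets and their correspondence with partitions *)

(* The beta-numbers (first-column hook lengths) of s padded with zero parts to N
   rows, in decreasing order. *)
Fixpoint beta (N : nat) (s : seq nat) : seq nat :=
  if N is M.+1 then (head 0 s + M) :: beta M (behead s) else [::].

(** Inverse of [beta]: an entry [x] followed by [r] entries encodes the part [x - r]. Reading stops
    at the first zero part, since in a strictly decreasing list all later parts are then zero
    too. *)
Fixpoint debeta (t : seq nat) : seq nat :=
  if t is x :: t' then
    if x - size t' is d.+1 then d.+1 :: debeta t' else [::]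
  else [::].

Lemma size_beta N s : size (beta N s) = N.
Proof. by elim: N s => //= N IH s; rewrite IH. Qed.

Lemma head_behead_geq s : sorted geq s -> head 0 (behead s) <= head 0 s.
Proof. by case: s => [|x [|y s]] //= /andP[]. Qed.

Lemma sorted_behead s : sorted geq s -> sorted geq (behead s).
Proof. by case: s => //= x s /path_sorted. Qed.

Lemma beta_path N s : sorted geq s -> path gtn (head 0 s + N) (beta N s).
Proof.
elim: N s => //= N IH s ss; rewrite addnS ltnSn /=.
have /IH := sorted_behead ss; case: (beta N _) => //= b t /andP[lt_b ->].
by rewrite andbT (leq_trans lt_b) // leq_add2r head_behead_geq.
Qed.

Lemma beta_sorted N s : sorted geq s -> sorted gtn (beta N s).
Proof. by move=> /beta_path => /(_ N)/path_sorted. Qed.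

Lemma beta_lt N s b : sorted geq s -> b \in beta N s -> b < head 0 s + N.
Proof.
move=> /beta_path => /(_ N) pb bin.
have tr : transitive gtn by move=> y x z /= xy yz; exact: ltn_trans yz xy.
by have := order_path_min tr pb => /allP/(_ _ bin).
Qed.

Lemma sumn_beta N s : size s <= N -> sumn (beta N s) = sumn s + 'C(N, 2).
Proof.
elim: N s => [|N IH] [|x s] //= le_s; rewrite IH // binS bin1 /=.
  by rewrite addnC.
by rewrite -!addnA; congr addn; rewrite addnCA; congr addn; rewrite addnC.
Qed.

Lemma beta_nil N : beta N [::] = rev (iota 0 N).
Proof. by elim: N => // N IH; rewrite -[in RHS]addn1 iotaD rev_cat /= IH. Qed.

Lemma betaK N s : sorted geq s -> 0 \notin s -> size s <= N ->
  debeta (beta N s) = s.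
Proof.
elim: N s => [|N IH] [|x s] //=; rewrite size_beta ?addnK ?subnn //.
rewrite inE negb_or => ps /andP[x0 s0] le_s.
rewrite IH ?(path_sorted ps) //.
by case: x x0 {ps}.
Qed.

Lemma size_debeta t : size (debeta t) <= size t.
Proof. by elim: t => //= x t IH; case: (x - _) => [|d] /=. Qed.

Lemma gtn_path_size x t : path gtn x t -> size t <= x.
Proof.
elim: t x => //= y t IH x /andP[lt_yx /IH le_ty].
exact: leq_ltn_trans lt_yx.
Qed.

(** Pigeonhole: [size t] distinct numbers below [size t] exhaust them. *)
Lemma gtn_path_rev_iota t : path gtn (size t) t -> t = rev (iota 0 (size t)).
Proof.
elim: t => // x t IH pxt.
have /andP[lt_x pt] : (x < (size t).+1) && path gtn x t by [].
have E : x = size t by apply/eqP; rewrite eqn_leq -ltnS lt_x gtn_path_size.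
by rewrite -[size (x :: t)]/(size t).+1 -addn1 iotaD rev_cat /= -IH -?E.
Qed.

Lemma debetaK t : sorted gtn t -> beta (size t) (debeta t) = t.
Proof.
elim: t => //= x t IH pt; have ge_x := gtn_path_size pt.
have := IH (path_sorted pt).
case E: (x - size t) => [|d] /= => [|->]; last by rewrite -E subnK.
have {ge_x E}Ex : x = size t by apply/eqP; rewrite eqn_leq ge_x -subn_eq0 E.
by move: pt; rewrite Ex beta_nil => /gtn_path_rev_iota <-.
Qed.

Lemma debeta_sorted t : sorted gtn t -> sorted geq (debeta t) /\ 0 \notin debeta t.
Proof.
elim: t => //= x t IH pt; have [s_t t0] := IH (path_sorted pt).
case E: (x - size t) => [|d] //; split; last by rewrite inE negb_or.
case: t {IH} pt E s_t {t0} => //= y t /andP[lt_yx _] E.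
by case F: (y - size t) => [|e] //= ->; rewrite andbT /=; lia.
Qed.

Lemma sumn_debeta t : sorted gtn t -> sumn (debeta t) + 'C(size t, 2) = sumn t.
Proof. by move=> st; rewrite -sumn_beta ?size_debeta // debetaK. Qed.

(** At least [k] padding rows contribute the beta-numbers from [0] to [k - 1]; every other
    beta-number is at least [k]. *)
Lemma count_beta_lt N k s : size s + k <= N -> count (gtn k) (beta N s) = k.
Proof.
elim: s N => [|x s IH] N /= le_N.
  rewrite beta_nil count_rev; move: le_N; rewrite add0n.
  elim: N => [|N IH].
    by rewrite leqn0 => /eqP->.
  rewrite leq_eqVlt => /predU1P[->|].
    rewrite -[RHS](size_iota 0) -count_predT; apply: eq_in_count => i.
    by rewrite mem_iota.
  rewrite ltnS => le_N; rewrite -[N.+1]addn1 iotaD count_cat IH //= add0n.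
  by rewrite ltnNge le_N !addn0.
case: N le_N => [|N] //; rewrite addSn ltnS => le_N /=.
by rewrite IH // ltnNge (leq_trans _ (leq_addl _ _)) // (leq_trans _ le_N) // leq_addl.
Qed.

(** A bead move on the abacus, from position [b] to position [c]; it adds a rim hook of length
    [c - b] if [b < c], and removes one of length [b - c] if [c < b]. *)
Definition swap (b c : nat) (t : seq nat) : seq nat := sort geq (c :: rem b t).

Lemma perm_swap b c t : perm_eq (swap b c t) (c :: rem b t).
Proof. by rewrite perm_sort. Qed.

Lemma geq_total : total geq.
Proof. by move=> x y /=; case: leqP => // /ltnW. Qed.

Lemma swap_sorted b c t : sorted gtn t -> c \notin t -> sorted gtn (swap b c t).
Proof.
rewrite !gtn_sorted_uniq_geq => /andP[ut st] ct.
rewrite (perm_uniq (perm_swap _ _ _)) sort_sorted ?andbT; last exact: geq_total.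
by rewrite /= rem_uniq // (contra _ ct) // => /mem_rem.
Qed.

Lemma size_swap b c t : b \in t -> size (swap b c t) = size t.
Proof.
move=> bt; rewrite size_sort /= size_rem //.
by case: t bt.
Qed.

Lemma sumn_swap b c t : b \in t -> sumn (swap b c t) + b = sumn t + c.
Proof.
move=> bt; rewrite (perm_sumn (perm_swap _ _ _)) (perm_sumn (perm_to_rem bt)) /=.
by lia.
Qed.

Lemma mem_swap b c t x : uniq t -> 
  (x \in swap b c t) = (x == c) || (x != b) && (x \in t).
Proof. by move=> ut; rewrite mem_sort inE mem_rem_uniq. Qed.

Lemma swapK b c t : sorted gtn t -> b \in t -> c \notin t -> swap c b (swap b c t) = t.
Proof.
move=> st bt ct; have := st; rewrite gtn_sorted_uniq_geq => /andP[ut sgt].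
have st' := swap_sorted b st ct.
have btc : b \notin swap b c t.
  by rewrite mem_swap // eqxx orbF; apply: contraNneq ct => <-.
apply: (irr_sorted_eq (leT := gtn)) => //.
- by move=> y x z /= xy yz; exact: ltn_trans yz xy.
- by move=> x /=; rewrite ltnn.
- exact: swap_sorted.
move=> x; rewrite !mem_swap //; last first.
  by move: st'; rewrite gtn_sorted_uniq_geq => /andP[].
have [->|xb] := eqVneq x b; first by rewrite bt.
have [->|xc] := eqVneq x c; last by [].
by rewrite (negbTE ct).
Qed.

(** * Reading hook lengths from the beta-set *)

Lemma count_iota_pred1 (a x : nat) (P : pred nat) :
  (forall s, 0 < s <= x -> P s = (s == a)) ->
  count P (iota 1 x) = (0 < a <= x) :> nat.
Proof.
move=> PE; rewrite -[_ <= x]ltnS -[x.+1]add1n -mem_iota.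
rewrite -count_uniq_mem ?iota_uniq //; apply: eq_in_count => s.
by rewrite mem_iota add1n ltnS => /PE.
Qed.

(* The numbers s - 1 + N - col_len l s are the non-members of the beta-set:
   they are the horizontal steps of the boundary path of the diagram. *)
Lemma count_beta_gap l N x m : sorted geq l -> size l <= N -> head 0 l <= x ->
  m < x + N ->
  count (fun s => s.-1 + N - col_len l s == m) (iota 1 x) = (m \notin beta N l).
Proof.
elim: l N x => [|y l IH] N x /=.
  move=> _ _ _ lt_m; rewrite beta_nil mem_rev mem_iota /=.
  case: (ltnP m N) => le_Nm.
    apply/eqP; rewrite eqn0Ngt -has_count; apply/hasPn => s.
    by rewrite mem_iota /col_len /=; lia.
  rewrite (@count_iota_pred1 (m - N).+1); first by lia.
  by move=> s; rewrite /col_len /=; lia.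
case: N => // N py; rewrite ltnS => le_N le_yx lt_m.
have ps := path_sorted py.
have le_y : all (geq y) l.
  by apply: order_path_min py => a b c /= ab bc; exact: leq_trans bc ab.
(* Columns up to [y] meet the first row, which cancels the extra row in [N.+1]; columns beyond [y]
   are empty and yield the consecutive gaps above the first bead [y + N]. *)
rewrite -(subnKC le_yx) iotaD count_cat.
have -> : count (fun s => s.-1 + N.+1 - col_len (y :: l) s == m) (iota 1 y) =
          count (fun s => s.-1 + N - col_len l s == m) (iota 1 y).
  apply: eq_in_count => s; rewrite mem_iota add1n ltnS => /andP[s0 sy].
  by rewrite /col_len /= sy add1n addnS subSS.
have -> : count (fun s => s.-1 + N.+1 - col_len (y :: l) s == m)
             (iota (1 + y) (x - y)) = (y + N < m) :> nat.
  rewrite addnC iotaDl count_map.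
  rewrite (@count_iota_pred1 (m - (y + N))); first by lia.
  move=> s /andP[s0 sx] /=; rewrite /col_len /= (@eq_in_count _ _ pred0).
    by rewrite count_pred0; lia.
  by move=> z /(allP le_y) /=; lia.
rewrite inE negb_or; case: (ltngtP m (y + N)) => [lt_my|gt_my|->] /=.
- rewrite IH ?addn0 //.
  by case: (l) py => //= z l' /andP[].
- rewrite (@eq_in_count _ _ pred0) ?count_pred0.
    suff -> : m \notin beta N l by [].
    apply/negP => /(beta_lt ps) lt_mz.
    have : head 0 l <= y by case: (l) py => //= z l' /andP[].
    by lia.
  by move=> s; rewrite mem_iota /=; lia.
- rewrite (@eq_in_count _ _ pred0) ?count_pred0 //.
  by move=> s; rewrite mem_iota /=; lia.
Qed.

Lemma cells_cons x l : cells (x :: l) =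
  [seq (1, s) | s <- iota 1 x] ++ [seq (c.1.+1, c.2) | c <- cells l].
Proof.
rewrite /cells /=; congr (_ ++ _).
rewrite map_flatten -map_comp (iotaDl 1 1) -map_comp; congr flatten.
by apply/eq_in_map => t; rewrite mem_iota => /andP[t0 _] /=; rewrite -map_comp; case: t t0.
Qed.

(** The hook length of a cell is the bead of its row minus the gap of its column, so cells of hook
    length [k] in a row correspond to a gap at distance [k] below its bead. Induction on the rows
    treats one bead at a time. *)
Lemma count_hook_beta k N l : 0 < k -> sorted geq l -> size l <= N ->
  count (fun c => hook_length l c == k) (cells l) =
  count (fun b => (k <= b) && (b - k \notin beta N l)) (beta N l).
Proof.
move=> k0; elim: l N => [|x l IH] N.
  move=> _ _; rewrite /= beta_nil; apply/esym/eqP; rewrite eqn0Ngt -has_count.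
  apply/hasPn => b; rewrite !mem_rev !mem_iota /=; lia.
case: N => // N px le_lN; have {le_lN}le_N : size l <= N by [].
have col_le s : col_len l s <= size l by exact: count_size.
have ps := path_sorted px.
have le_x : head 0 l <= x by case: (l) px => //= z l' /andP[].
rewrite cells_cons count_cat !count_map /=; congr addn.
  rewrite inE negb_or.
  case: (leqP k (x + N)) => [le_k|lt_k] /=; last first.
    rewrite (@eq_in_count _ _ pred0) ?count_pred0 // => s.
    rewrite mem_iota /= /row_len /= => /andP[s0 sx].
    have := col_le s; rewrite /col_len /= -!/(col_len _ _); lia.
  rewrite (_ : _ - k == _ = false) /=; last by lia.
  rewrite -(@count_beta_gap l N x) //; last by lia.
  apply: eq_in_count => s; rewrite mem_iota /= /row_len /= => /andP[s0 sx].
  have := col_le s; rewrite /col_len /= -!/(col_len _ _); lia.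
(* Deleting the first row keeps the hooks of the other rows, and the deleted bead exceeds every
   other bead, so it is never of the form [b - k]. *)
rewrite (eq_in_count (a2 := fun c => hook_length l c == k)).
  rewrite (IH N) //; apply: eq_in_count => b /(beta_lt ps) lt_b.
  rewrite inE negb_or (_ : b - k == _ = false) //; lia.
case=> t s; rewrite mem_cells /= => /andP[/andP[t0 tl] /andP[s0 sr]].
rewrite /col_len /=.
have -> : row_len (x :: l) t.+1 = row_len l t by rewrite /row_len; case: t t0 {tl sr}.
suff -> : s <= x by lia.
apply: leq_trans sr _; rewrite /row_len.
have : all (geq x) l.
  by apply: order_path_min px => a b c /= ab bc; exact: leq_trans bc ab.
by move/(all_nthP 0); apply; rewrite prednK.
Qed.

Lemma count_addn_mem k (t : seq nat) : uniq t ->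
  count (fun b => b + k \in t) t = count (fun b => (k <= b) && (b - k \in t)) t.
Proof.
move=> ut; rewrite -!size_filter -(size_map (addn^~ k)).
apply/perm_size/uniq_perm; rewrite ?filter_uniq //.
  by rewrite map_inj_uniq ?filter_uniq //; exact: addIn.
move=> b; rewrite mem_filter; apply/mapP/idP => [[c]|/andP[/andP[kb bt] bt']].
  by rewrite mem_filter => /andP[ckt ct] ->; rewrite leq_addl addnK ct.
by exists (b - k); rewrite ?mem_filter ?subnK // bt' bt.
Qed.

(** Shifting by [k] matches the beads with a bead [k] above them and the beads with a bead [k] below
    them. Hence the two counts of free moves differ by the number of beads below [k], which is [k]
    by [count_beta_lt]. *)
Lemma count_add_beta k N l : sorted geq l -> size l + k <= N ->
  count (fun b => b + k \notin beta N l) (beta N l) =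
  count (fun b => (k <= b) && (b - k \notin beta N l)) (beta N l) + k.
Proof.
move=> sl le_N.
have ut : uniq (beta N l) by have := beta_sorted N sl; rewrite gtn_sorted_uniq_geq => /andP[].
have E1 := count_predC (fun b => b + k \in beta N l) (beta N l).
have E2 := count_predC (leq k) (beta N l).
have E3 : count (leq k) (beta N l) =
    count (fun b => (k <= b) && (b - k \in beta N l)) (beta N l) +
    count (fun b => (k <= b) && (b - k \notin beta N l)) (beta N l).
  rewrite -count_predUI [X in _ + X](@eq_count _ _ pred0) ?count_pred0 ?addn0.
    by apply: eq_count => b /=; rewrite -andb_orr orbN andbT.
  by move=> b /=; rewrite andbACA andbN andbF.
have E4 := count_beta_lt le_N.
have E5 : count (predC (leq k)) (beta N l) = k.
  by rewrite -[RHS]E4; apply: eq_count => b /=; rewrite -ltnNge.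
rewrite count_addn_mem // in E1; rewrite E5 E3 -E1 in E2.
apply: (@addnI (count (fun b => (k <= b) && (b - k \in beta N l)) (beta N l))).
by rewrite addnA E2.
Qed.

(** * Counting hooks of length [k] over all partitions of [n] *)

Section Partitions.
Variable n : nat.
Implicit Type l : partition_of n.

Lemma partition_sorted l : sorted geq l.
Proof. by case: l => l /= /and3P[]. Qed.

Lemma partition_notin0 l : 0 \notin (l : seq nat).
Proof. by case: l => l /= /and3P[]. Qed.

Lemma partition_sumn l : sumn l = n.
Proof. by case: l => l /= /and3P[_ _ /eqP]. Qed.

Lemma partition_size l : size l <= n.
Proof. by rewrite -[leqRHS](partition_sumn l) size_le_sumn // partition_notin0. Qed.

End Partitions.

Lemma ones_partition n : is_partition n (nseq n 1).
Proof.
rewrite /is_partition sumn_nseq mul1n eqxx andbT mem_nseq andbF andbT.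
by case: n => //= n; elim: n.
Qed.

(** The partition into ones is only a default, returned when [debeta t] is not a partition of
    [m]. *)
Definition of_beta m (t : seq nat) : partition_of m :=
  insubd (PartitionOf (ones_partition m)) (debeta t).

Lemma beta_of_beta m t : sorted gtn t -> sumn t = m + 'C(size t, 2) ->
  beta (size t) (of_beta m t) = t.
Proof.
move=> st sumt; rewrite val_insubd ifT ?debetaK // /is_partition.
have [-> ->] := debeta_sorted st.
by rewrite -(eqn_add2r 'C(size t, 2)) sumn_debeta //= sumt.
Qed.

Lemma of_betaK m N (l : partition_of m) : m <= N -> of_beta m (beta N l) = l.
Proof.
move=> le_N; apply/val_inj; rewrite val_insubd betaK ?partition_sorted ?partition_notin0 //.
  by case: l => l /= ->.
exact: leq_trans (partition_size l) le_N.
Qed.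

Lemma beta_move n m N (l : partition_of n) b c : n <= N ->
  b \in beta N l -> c \notin beta N l -> n + c = m + b ->
  beta N (of_beta m (swap b c (beta N l))) = swap b c (beta N l).
Proof.
move=> le_N bl cl E; have sl := partition_sorted l.
have sz : size (swap b c (beta N l)) = N by rewrite size_swap // size_beta.
have := @beta_of_beta m (swap b c (beta N l)); rewrite sz; apply.
  exact: swap_sorted (beta_sorted N sl) cl.
have := sumn_swap c bl; rewrite sumn_beta ?partition_sumn; first by lia.
exact: leq_trans (partition_size l) le_N.
Qed.

(** An injection between disjoint unions; total functions on plain pairs avoid dependent types, and
    [g] need only invert [f] on the pairs concerned. *)
Lemma sum_size_leq (T1 T2 : finType) (A : T1 -> seq nat) (B : T2 -> seq nat)
    (f : T1 * nat -> T2 * nat) (g : T2 * nat -> T1 * nat) :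
  (forall l, uniq (A l)) ->
  (forall l b, b \in A l -> (f (l, b)).2 \in B (f (l, b)).1) ->
  (forall l b, b \in A l -> g (f (l, b)) = (l, b)) ->
  \sum_l size (A l) <= \sum_l size (B l).
Proof.
move=> uA fB fK.
have sumE (T : finType) (C : T -> seq nat) :
    \sum_l size (C l) = size [seq (l, b) | l <- enum T, b <- C l].
  by rewrite size_allpairs_dep sumnE big_map big_enum.
rewrite !sumE -(size_map f); apply: uniq_leq_size.
  rewrite map_inj_in_uniq.
    apply: allpairs_uniq_dep; rewrite ?enum_uniq //.
    by move=> [a b] [c d] _ _ /= [-> ->].
  move=> x y /allpairsPdep[l [b [_ bl ->]]] /allpairsPdep[l' [b' [_ bl' ->]]] E.
  by rewrite -(fK _ _ bl) E fK.
move=> x /mapP[z /allpairsPdep[l [b [_ bl ->]]] ->].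
apply/allpairsPdep; exists (f (l, b)).1, (f (l, b)).2.
by rewrite mem_enum fB // -surjective_pairing.
Qed.

Definition nhooks n k : nat :=
  \sum_(l : partition_of n) count (fun c => hook_length l c == k) (cells l).

(** Removing a hook of length [k] from a partition of [n + k] is inverse to adding one to a
    partition of [n]; [count_add_beta] then converts additions into removals. *)
Lemma nhooks_add n k : 0 < k -> nhooks (n + k) k = nhooks n k + k * npartitions n.
Proof.
(* With [n + k] rows every partition of [n] has the [k] padding rows that [count_add_beta] requires,
   and all partitions of [n + k] fit as well. *)
move=> k0; set N := n + k.
rewrite /nhooks.
rewrite (eq_bigr (fun l : partition_of N => size [seq b <- beta N l |
    (k <= b) && (b - k \notin beta N l)])); last first.
  move=> l _; rewrite size_filter (@count_hook_beta _ N) ?partition_sorted //.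
  exact: partition_size.
rewrite mulnC /npartitions -sum_nat_const -big_split /=.
rewrite (eq_bigr (fun l : partition_of n => size [seq b <- beta N l |
    b + k \notin beta N l])); last first.
  move=> l _; have le_l := partition_size l.
  rewrite size_filter (@count_hook_beta _ N) ?partition_sorted //; last by lia.
  by rewrite count_add_beta ?partition_sorted //; lia.
have uniq_beta m (l : partition_of m) : uniq (beta N l).
  by have := beta_sorted N (partition_sorted l); rewrite gtn_sorted_uniq_geq => /andP[].
have sorted_beta m (l : partition_of m) : sorted gtn (beta N l).
  exact/beta_sorted/partition_sorted.
(* The second component records the new position of the moved bead, which is what the inverse map
   needs to move it back. *)
pose f (x : partition_of n * nat) :=
  (of_beta N (swap x.2 (x.2 + k) (beta N x.1)), x.2 + k).
pose g (x : partition_of N * nat) :=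
  (of_beta n (swap x.2 (x.2 - k) (beta N x.1)), x.2 - k).
apply/eqP; rewrite eqn_leq; apply/andP; split.
- apply: (@sum_size_leq _ _ _ _ g f) => [l|l b|l b]; rewrite ?filter_uniq ?mem_filter //=.
    move=> /andP[/andP[kb bkl] bl].
    rewrite subnK // beta_move //; [|by rewrite /N; lia..].
    rewrite !mem_swap // eqxx /= ?orbF ?andbT; lia.
  move=> /andP[/andP[kb bkl] bl]; rewrite /f /g /= subnK //.
  rewrite beta_move //; [|by rewrite /N; lia..].
  by rewrite swapK ?of_betaK.
- apply: (@sum_size_leq _ _ _ _ f g) => [l|l b|l b]; rewrite ?filter_uniq ?mem_filter //=.
    move=> /andP[bkl bl].
    rewrite addnK beta_move //; [|by rewrite /N; lia..].
    rewrite !mem_swap // eqxx /= ?orbF ?andbT leq_addl /=; lia.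
  move=> /andP[bkl bl]; rewrite /f /g /= addnK.
  rewrite beta_move //; [|by rewrite /N; lia..].
  by rewrite swapK ?of_betaK //; rewrite /N; lia.
Qed.

(** Removing such a hook would leave [n] distinct beads with sum below ['C(n, 2)], the least
    possible. *)
Lemma nhooks_eq0 n k : n < k -> nhooks n k = 0.
Proof.
move=> lt_nk; rewrite /nhooks big1 // => l _.
have le_l := partition_size l; have sl := partition_sorted l.
rewrite (@count_hook_beta _ n) //; last by lia.
apply/eqP; rewrite eqn0Ngt -has_count; apply/hasPn => b bl.
apply/negP => /andP[kb bkl].
have := sumn_debeta (swap_sorted b (beta_sorted n sl) bkl).
have := sumn_swap (b - k) bl.
rewrite size_swap // size_beta sumn_beta // partition_sumn; lia.
Qed.

(** Iterates [nhooks_add] along [n], [n - k], [n - 2 k], and so on. The upper bound [N] is left free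
    for the induction; terms with [j * k > n] vanish. *)
Lemma nhooksE n k N : 0 < k -> n <= N ->
  nhooks n k =
  \sum_(1 <= j < N.+1) (if j * k <= n then k * npartitions (n - j * k) else 0).
Proof.
move=> k0; elim/ltn_ind: n N => n IH N le_nN.
case: (ltnP n k) => [lt_nk|le_kn].
  rewrite nhooks_eq0 // big_nat big1 // => j /andP[j0 _].
  by rewrite ifF //; apply/negbTE; rewrite -ltnNge (leq_trans lt_nk) // leq_pmull.
case: N le_nN => [|N] le_nN; first by lia.
rewrite -{1}(subnK le_kn) nhooks_add // (IH (n - k) _ N); [|lia..].
rewrite [RHS]big_ltn // mul1n le_kn addnC; congr addn.
rewrite [RHS]big_add1 /=; apply: eq_bigr => j _.
by rewrite mulSn leq_subRL // subnDA.
Qed.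

Lemma hook_length_gt0 l c : 0 < hook_length l c.
Proof. by case: c => t s; rewrite /hook_length addn1. Qed.

Lemma hook_length_leq n (l : partition_of n) c :
  c \in cells l -> hook_length l c <= n.
Proof.
move=> cl; rewrite leqNgt; apply/negP => /nhooks_eq0/eqP.
rewrite /nhooks sum_nat_eq0 => /forallP/(_ l).
by rewrite eqn0Ngt -has_count => /hasPn/(_ c cl); rewrite eqxx.
Qed.

(** * Exact counting formulas for bounded hook length *)

Lemma card_Omega_pred n (P : pred nat) :
  #|[pred w : Omega n | P (Z w)]| =
  \sum_(l : partition_of n) count (fun c => P (hook_length l c)) (cells l).
Proof.
rewrite -sum1_card /= /Z.
rewrite -(@sig_big_dep _ _ _ _ (fun l : partition_of n => seq_sub (cells l)) predT
  (fun l c => P (hook_length l (val c))) (fun _ _ => 1)) /=.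
apply: eq_bigr => l _; rewrite sum1_count.
rewrite -(count_map val (fun c => P (hook_length l c))).
by rewrite -[index_enum _]enumT enumT unlock val_seq_sub_enum ?cells_uniq.
Qed.

Lemma card_Z_leq n K :
  #|[pred w : Omega n | Z w <= K]| =
  \sum_(1 <= j < n.+1) \sum_(1 <= k < K.+1)
    (if j * k <= n then k * npartitions (n - j * k) else 0).
Proof.
rewrite (card_Omega_pred _ (fun h => h <= K)) exchange_big_nat /=.
rewrite [RHS](eq_big_nat _ _ (F2 := nhooks n)); last first.
  by move=> k /andP[k0 _]; rewrite (@nhooksE _ _ n).
rewrite [RHS]exchange_big /=; apply: eq_bigr => l _.
elim: (cells l) => [|c s IH] /=; first by rewrite big1.
rewrite big_split /= -IH; congr addn.
rewrite (eq_bigr (fun i => if pred1 (hook_length l c) i then 1 else 0)); last first.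
  by move=> i _; rewrite /= eq_sym; case: eqP.
rewrite -big_mkcond sum1_count count_uniq_mem ?iota_uniq // mem_index_iota ltnS.
by rewrite hook_length_gt0.
Qed.

(** No hook is longer than [n], so [card_Z_leq] at [K = n] counts the whole sample space. *)
Lemma mul_npartitions n :
  n * npartitions n =
  \sum_(1 <= j < n.+1) \sum_(1 <= k < n.+1)
    (if j * k <= n then k * npartitions (n - j * k) else 0).
Proof.
rewrite -card_Z_leq -card_Omega; apply: eq_card => w; rewrite !inE.
by rewrite /Z hook_length_leq // ssvalP.
Qed.

(** Appending a part equal to [1] is injective. *)
Lemma leq_npartitions n : npartitions n <= npartitions n.+1.
Proof.
have rP (l : partition_of n) : is_partition n.+1 (rcons l 1).
  rewrite /is_partition sumn_rcons partition_sumn addn1 eqxx andbT.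
  rewrite mem_rcons inE /= partition_notin0 andbT.
  have := partition_sorted l; have := partition_notin0 l.
  case: (l : seq nat) => //= x s; rewrite rcons_path => l0 ->.
  rewrite /= lt0n; apply: contraNneq l0 => <-; exact: mem_last.
apply: (@leq_card _ _ (fun l => PartitionOf (rP l))) => l l' /(congr1 (@parts _)) /=.
by move=> /rcons_inj[] /val_inj.
Qed.

Lemma Pr_card (R : realType) n (A : pred (Omega n)) :
  Pr R A = (#|A|%:R / (n * npartitions n)%:R)%R.
Proof. by rewrite /Pr sumr_const mulr_natl. Qed.

Local Open Scope classical_set_scope.
Local Open Scope ring_scope.

(** * Dominated convergence for sums, and the Riccati recursion *)

Lemma cvg_tannery (R : realType) (u : nat -> nat -> R) (a b : nat -> R) :
  (forall j, u ^~ j @ \oo --> a j) ->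
  (forall n j, `|u n j| <= b j) -> cvgn (series b) ->
  (fun n => \sum_(0 <= j < n) u n j) @ \oo --> limn (series a).
Proof.
move=> u_a u_b cvg_b.
have a_b j : `|a j| <= b j.
  have cu : (fun n => `|u n j|) @ \oo --> `|a j| by apply: cvg_norm; exact: u_a.
  rewrite -(cvg_lim _ cu) //; apply: limr_le; first by apply/cvg_ex; eexists; exact: cu.
  by apply: nearW => n; exact: u_b.
have b_ge0 j : 0 <= b j by apply: le_trans (a_b j).
have cvg_a : cvgn (series a).
  by apply: normed_cvg; apply: series_le_cvg cvg_b => // n; exact: normr_ge0.
have nd_b : nondecreasing_seq (series b).
  by apply/nondecreasing_seqP => n; rewrite seriesSr lerDl.
have b_le n := nondecreasing_cvgn_le nd_b cvg_b n.
(* Four errors of [e / 4]: the series of [a] beyond [n], the first [J] terms, and the stretches from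
   [J] to [n] of [a] and of [u n]. *)
apply/cvgrPdist_le => e e0; have e4 : 0 < e / 4 by rewrite divr_gt0.
have [J _ tailJ] : \forall J \near \oo, `|limn (series b) - series b J| <= e / 4.
  by move/cvgrPdist_le : cvg_b; apply.
have {}tailJ := tailJ J (leqnn J).
have cvg_head : (fun n => \sum_(0 <= j < J) u n j) @ \oo --> \sum_(0 <= j < J) a j.
  elim: J {tailJ} => [|J IH].
    by under eq_fun do rewrite big_geq //; rewrite big_geq //; exact: cvg_cst.
  under eq_fun do rewrite big_nat_recr //=.
  by rewrite big_nat_recr //=; exact: cvgD IH (u_a J).
near=> n.
have le_Jn : (J <= n)%N by near: n; exact: nbhs_infty_ge.
have tail_le (v : nat -> R) : (forall j, `|v j| <= b j) ->
    `|\sum_(J <= j < n) v j| <= e / 4.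
  move=> v_b; apply: le_trans (ler_norm_sum _ _ _) _.
  apply: (@le_trans _ _ (\sum_(J <= j < n) b j)); first exact: ler_sum.
  apply: le_trans tailJ; apply: le_trans (ler_norm _).
  by rewrite lerBrDr addrC -big_cat_nat //=; exact: b_le.
have a1 : `|limn (series a) - series a n| <= e / 4.
  by near: n; move/cvgrPdist_le : cvg_a; apply.
have a2 : `|\sum_(0 <= j < J) a j - \sum_(0 <= j < J) u n j| <= e / 4.
  by near: n; move/cvgrPdist_le : cvg_head; apply.
have a3 := tail_le a a_b; have a4 := tail_le (u n) (u_b n).
move: a1 a2 a3 a4; rewrite /series /= !(big_cat_nat (n := J) (m := 0) (p := n)) //=.
by rewrite !ler_norml; lra.
Unshelve. all: by end_near. Qed.

(** The map [V |-> 1 + V / (1 + k V)] is increasing, so a lower bound [W] propagates: the next value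
    is at least [1 + W - k W^2], and for [W = s sqrt m - B] this exceeds the next bound because
    [k W^2] plus the increment of [s sqrt m] is at most [1]. *)
Lemma riccati_ge (R : realType) (V k : nat -> R) (s : R) : 0 < s ->
  (forall n, 1 <= V n) -> (forall n, 0 <= k n) ->
  (forall n, V n.+1 = 1 + V n / (1 + k n.+1 * V n)) ->
  (\forall n \near \oo, n%:R * k n <= (s ^+ 2)^-1) ->
  exists B, \forall n \near \oo, s * Num.sqrt n%:R - B <= V n.
Proof.
move=> s0 V1 k0 rec [N _ leN].
(* From [M] on, [m >= s ^+ 2], that is, [s <= sqrt m]. *)
pose M := (N + (Num.truncn (s ^+ 2)).+1)%N.
(* The term [s * sqrt M] makes the bound negative at [M]; the term [s ^+ 2] gains the [- s * r] that
   pays for the increment of the square root in [step]. *)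
pose B := s ^+ 2 + s * Num.sqrt M%:R.
have B0 : s ^+ 2 <= B by rewrite lerDl mulr_ge0 ?sqrtr_ge0 // ltW.
exists B, M => // n /= le_Mn; rewrite -(subnK le_Mn).
elim: (n - M)%N => [|i IH]; first by rewrite add0n /B; have := V1 M; nra.
rewrite addSn; set m := (i + M)%N in IH *.
have m1 : 1 <= m%:R :> R by rewrite ler1n /m /M addnS addnS.
have := rec m; set k' := k m.+1 => ->; have {}k0 : 0 <= k' by exact: k0.
have kle : (m%:R + 1) * k' <= (s ^+ 2)^-1.
  by rewrite natr1; apply: leN; rewrite /= /m /M; lia.
have r2 : Num.sqrt m%:R ^+ 2 = m%:R :> R by rewrite sqr_sqrtr.
have r2' : Num.sqrt m.+1%:R ^+ 2 = m%:R + 1 :> R by rewrite sqr_sqrtr // natr1.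
have r0 : 0 <= Num.sqrt m%:R :> R by exact: sqrtr_ge0.
have rr : Num.sqrt m%:R <= Num.sqrt m.+1%:R :> R by rewrite ler_sqrt // ler_nat.
have ms : s ^+ 2 <= m%:R.
  by apply/ltW; apply: lt_le_trans (truncnS_gt _) _; rewrite ler_nat /m /M addnA leq_addl.
move: IH r2 r2' r0 rr; have {}V1 := V1 m.
set r := Num.sqrt m%:R; set r' := Num.sqrt m.+1%:R => IH r2 r2' r0 rr.
have sr : s <= r by rewrite -(@ler_sqr _ s r) ?nnegrE ?(ltW s0) // r2.
have rpos : 0 < r by exact: lt_le_trans sr.
have drr : 2 * r * (r' - r) <= 1.
  have : (r' + r) * (r' - r) = 1 by ring: r2 r2'.
  nra.
have Vpos : 0 <= V m / (1 + k' * V m).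
  by rewrite divr_ge0 ?addr_ge0 ?mulr_ge0 // (le_trans _ V1).
have [W0|W0] := leP (s * r - B) 0.
  have : s * (r' - r) <= 1 by nra.
  by lra.
set W := s * r - B in W0 IH.
have kW0 : 0 <= k' * W by rewrite mulr_ge0 // ltW.
have VW : W / (1 + k' * W) <= V m / (1 + k' * V m).
  have kV0 : 0 <= k' * V m by rewrite mulr_ge0 // (le_trans _ V1).
  rewrite ler_pdivrMr; last by lra.
  rewrite mulrAC ler_pdivlMr; last by lra.
  by nra.
have WW : W - k' * W ^+ 2 <= W / (1 + k' * W).
  rewrite ler_pdivlMr; last by lra.
  have : 0 <= (k' * W) ^+ 2 * W by rewrite mulr_ge0 ?sqr_ge0 // ltW.
  by nra.
have step : s * (r' - r) + k' * W ^+ 2 <= 1.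
  have mp : 0 < (m%:R + 1 : R) by lra.
  rewrite -(ler_pM2l mp) mulr1 mulrDr.
  have h1 : (m%:R + 1) * (k' * W ^+ 2) <= r ^+ 2 - s * r.
    apply: (@le_trans _ _ ((s ^+ 2)^-1 * W ^+ 2)).
      by rewrite mulrA ler_wpM2r ?sqr_ge0.
    rewrite mulrC ler_pdivrMr ?exprn_gt0 //.
    apply: (@le_trans _ _ (W * (s * r))).
      rewrite expr2 ler_wpM2l ?(ltW W0) // /W; have := sqr_ge0 s; lra.
    rewrite /W; have srp : 0 <= s * r by rewrite mulr_ge0 // ltW.
    by nra.
  have h2 : (m%:R + 1) * (s * (r' - r)) <= s * r.
    rewrite mulrCA ler_pM2l //; nra.
  by lra.
have EW : W = s * r - B by [].
by clearbody W; lra.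
Qed.

(** Same monotone map: for an upper bound [W = s sqrt m + B], the next value is at most [W] itself
    as soon as [1 <= k W (W - 1)], and this follows from [W (W - 1) >= (s sqrt m + s)^2 >= s^2 (m +
    1)]. *)
Lemma riccati_le (R : realType) (V k : nat -> R) (s : R) : 0 < s ->
  (forall n, 1 <= V n) -> (forall n, 0 <= k n) ->
  (forall n, V n.+1 = 1 + V n / (1 + k n.+1 * V n)) ->
  (\forall n \near \oo, (s ^+ 2)^-1 <= n%:R * k n) ->
  exists B, \forall n \near \oo, V n <= s * Num.sqrt n%:R + B.
Proof.
move=> s0 V1 k0 rec [M _ leN].
pose B := 1 + s + V M.
have B0 : 1 + s <= B by rewrite /B; have := V1 M; lra.
exists B, M => // n /= le_Mn; rewrite -(subnK le_Mn).
elim: (n - M)%N => [|i IH].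
  rewrite add0n /B; have := sqrtr_ge0 (M%:R : R); have := V1 M; nra.
rewrite addSn; set m := (i + M)%N in IH *.
have := rec m; set k' := k m.+1 => ->; have {}k0 : 0 <= k' by exact: k0.
have kle : (s ^+ 2)^-1 <= (m%:R + 1) * k'.
  by rewrite natr1; apply: leN; rewrite /= /m; lia.
have r2 : Num.sqrt m%:R ^+ 2 = m%:R :> R by rewrite sqr_sqrtr.
have r0 : 0 <= Num.sqrt m%:R :> R by exact: sqrtr_ge0.
have rr : Num.sqrt m%:R <= Num.sqrt m.+1%:R :> R by rewrite ler_sqrt // ler_nat.
move: IH r2 r0 rr; have {}V1 := V1 m.
set r := Num.sqrt m%:R; set r' := Num.sqrt m.+1%:R; set W := s * r + B => IH r2 r0 rr.
have sr0 : 0 <= s * r by rewrite mulr_ge0 // ltW.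
have kW0 : 0 <= k' * W by rewrite mulr_ge0 // /W; lra.
have kV0 : 0 <= k' * V m by rewrite mulr_ge0 //; lra.
have VW : V m / (1 + k' * V m) <= W / (1 + k' * W).
  rewrite ler_pdivrMr; last by lra.
  rewrite mulrAC ler_pdivlMr; last by lra.
  by nra.
have WW : W / (1 + k' * W) <= W - 1.
  rewrite ler_pdivrMr; last by lra.
  suff : 1 <= k' * W * (W - 1) by lra.
  have m0 : 0 < m%:R + 1 :> R by rewrite natr1 ltr0n.
  rewrite -(ler_pM2l m0) mulr1.
  have WW0 : s ^+ 2 * (m%:R + 1) <= W * (W - 1).
    apply: (@le_trans _ _ ((s * r + s) * (s * r + s))); first by rewrite -r2; nra.
    by apply: ler_pM; rewrite /W; lra.
  apply: (@le_trans _ _ ((s ^+ 2)^-1 * (W * (W - 1)))).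
    by rewrite mulrC ler_pdivlMr ?exprn_gt0 // mulrC.
  have -> : (m%:R + 1) * (k' * W * (W - 1)) = (m%:R + 1) * k' * (W * (W - 1)) by ring.
  rewrite ler_wpM2r //; apply: le_trans WW0; rewrite mulr_ge0 ?sqr_ge0 //; lra.
have : s * r <= s * r' by rewrite ler_pM2l.
have EW : W = s * r + B by [].
by clearbody W; lra.
Qed.

Lemma near_sqrt_ge (R : realType) (A : R) :
  \forall n \near \oo, A <= Num.sqrt n%:R.
Proof.
near=> n; apply: le_trans (ler_norm A) _; rewrite -sqrtr_sqr ler_wsqrtr //.
by near: n; exact: nbhs_infty_ger.
Unshelve. all: by end_near. Qed.

Lemma riccati_cvg (R : realType) (V k : nat -> R) (L : R) : 0 < L ->
  (forall n, 1 <= V n) -> (forall n, 0 <= k n) ->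
  (forall n, V n.+1 = 1 + V n / (1 + k n.+1 * V n)) ->
  (fun n => n%:R * k n) @ \oo --> L ->
  (fun n => V n / Num.sqrt n%:R) @ \oo --> (Num.sqrt L)^-1.
Proof.
move=> L0 V1 k0 rec kL.
set l := (Num.sqrt L)^-1.
have l0 : 0 < l by rewrite invr_gt0 sqrtr_gt0.
have LE : L = (l ^+ 2)^-1 by rewrite /l exprVn invrK sqr_sqrtr // ltW.
apply/cvgrPdist_le => e e0.
have e2 : 0 < e / 2 by rewrite divr_gt0.
(* The second argument of the maximum keeps [s] positive when [e] is large. *)
pose s := Num.max (l - e / 2) (l / 2).
have [s0 sl le_s] : [/\ 0 < s, s < l & l - e / 2 <= s].
  by rewrite /s; split; [rewrite lt_max|rewrite gt_max|rewrite le_max]; lra.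
have sq_lt (x y : R) : 0 < x -> x < y -> (y ^+ 2)^-1 < (x ^+ 2)^-1.
  move=> x0 xy; rewrite ltf_pV2 ?posrE ?exprn_gt0 //; last by lra.
  by rewrite ltr_sqr ?nnegrE; lra.
have [B geV] : exists B, \forall n \near \oo, s * Num.sqrt n%:R - B <= V n.
  apply: riccati_ge rec _ => //.
  by apply: (cvgr_le L) kL _ _; rewrite LE sq_lt.
have [C leV] : exists C, \forall n \near \oo, V n <= (l + e / 2) * Num.sqrt n%:R + C.
  apply: riccati_le rec _ => //; first by lra.
  by apply: (cvgr_ge L) kL _ _; rewrite LE sq_lt //; lra.
near=> n.
have n0 : 0 < Num.sqrt n%:R :> R.
  by rewrite sqrtr_gt0 ltr0n; near: n; exact: nbhs_infty_gt.
have Bn : B / (e / 2) <= Num.sqrt n%:R by near: n; exact: near_sqrt_ge.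
have Cn : C / (e / 2) <= Num.sqrt n%:R by near: n; exact: near_sqrt_ge.
rewrite !ler_pdivrMr // in Bn Cn.
have ge_n : s * Num.sqrt n%:R - B <= V n by near: n; exact: geV.
have le_n : V n <= (l + e / 2) * Num.sqrt n%:R + C by near: n; exact: leV.
rewrite distrC ler_distl ler_pdivlMr // ler_pdivrMr //.
by nra.
Unshelve. all: by end_near. Qed.

Lemma near_cvg (R : realType) (f g : nat -> R) (l : R) :
  (\forall n \near \oo, f n = g n) -> g @ \oo --> l -> f @ \oo --> l.
Proof.
move=> fg; apply: cvg_trans; apply: near_eq_cvg.
by apply: filterS fg => n.
Qed.

Lemma cvg_inv_sqrt (R : realType) : (fun n : nat => (Num.sqrt n%:R)^-1 : R) @ \oo --> 0.
Proof.
apply/cvgrPdist_le => e e0; near=> n.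
have n0 : 0 < Num.sqrt n%:R :> R.
  by rewrite sqrtr_gt0 ltr0n; near: n; exact: nbhs_infty_gt.
rewrite sub0r normrN ger0_norm ?invr_ge0 ?sqrtr_ge0 // -[leRHS]invrK lef_pV2 ?posrE ?invr_gt0 //.
by near: n; exact: near_sqrt_ge.
Unshelve. all: by end_near. Qed.

(** * Increments of order [sqrt n] *)

Section SqrtIncrement.
Variables (R : realType) (v : nat -> nat) (x : R).
Hypothesis v_le : \forall n \near \oo, (v n <= n)%N.
Hypothesis v_cvg : (fun n => (v n)%:R / Num.sqrt n%:R) @ \oo --> x.

Lemma cvg_sqrt_sub : (fun n => Num.sqrt (n - v n)%:R / Num.sqrt n%:R : R) @ \oo --> (1 : R).
Proof.
have h : (fun n => (n - v n)%:R / n%:R : R) @ \oo --> (1 : R).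
  rewrite -[X in _ --> X]subr0 -[X in _ --> _ - X](mulr0 x).
  have h0 : (fun n => 1 - (v n)%:R / Num.sqrt n%:R * (Num.sqrt n%:R)^-1 : R) @ \oo --> 1 - x * 0.
    by apply: cvgB; [exact: cvg_cst|apply: cvgM; [exact: v_cvg|exact: cvg_inv_sqrt]].
  apply: near_cvg h0.
  near=> n; have n0 : n%:R != 0 :> R.
    by rewrite pnatr_eq0 -lt0n; near: n; exact: nbhs_infty_gt.
  have vn : (v n <= n)%N by near: n.
  by rewrite natrB // mulrBl divff // -mulrA -invfM -expr2 sqr_sqrtr.
have h1 : (fun n => Num.sqrt ((n - v n)%:R / n%:R) : R) @ \oo --> (Num.sqrt 1 : R).
  by apply: continuous_cvg h; exact: sqrt_continuous.
rewrite sqrtr1 in h1; apply: near_cvg h1; apply: nearW => n.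
by rewrite sqrtrM // sqrtrV.
Unshelve. all: by end_near. Qed.

Lemma cvg_sub_infty : (fun n => n - v n)%N @ \oo --> \oo.
Proof.
move=> A [N _ NA]; suff : \forall n \near \oo, A (n - v n)%N by [].
have h : \forall n \near \oo, 1 / 2 <= Num.sqrt (n - v n)%:R / Num.sqrt n%:R :> R.
  by apply: (cvgr_ge 1) cvg_sqrt_sub _ _; lra.
near=> n; apply: NA; rewrite /= -(ler_nat R).
have n0 : 0 < Num.sqrt n%:R :> R.
  by rewrite sqrtr_gt0 ltr0n; near: n; exact: nbhs_infty_gt.
have : 1 / 2 <= Num.sqrt (n - v n)%:R / Num.sqrt n%:R :> R by near: n.
rewrite ler_pdivlMr // => h1.
have h2 : 2 * (N%:R + 1) <= Num.sqrt n%:R :> R by near: n; exact: near_sqrt_ge.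
have h3 : Num.sqrt (n - v n)%:R ^+ 2 = (n - v n)%:R :> R by rewrite sqr_sqrtr.
have h4 : 0 <= N%:R :> R by [].
nra.
Unshelve. all: by end_near. Qed.

Lemma near_sub_gt N : \forall n \near \oo, (N < n - v n)%N.
Proof. exact: (@cvg_sub_infty [set n | (N < n)%N] (nbhs_infty_gt N)). Qed.

(** The window holds about [x sqrt n] indices [i], on all of which [sqrt i] is asymptotic to
    [sqrt n], so each term is about [c / sqrt n]. *)
Lemma cvg_sum_sqrt (d : nat -> R) (c : R) :
  (fun n => Num.sqrt n%:R * d n) @ \oo --> c ->
  (fun n => \sum_(n - v n <= i < n) d i) @ \oo --> c * x.
Proof.
move=> d_c.
pose s n : R := \sum_(n - v n <= i < n) (Num.sqrt i%:R)^-1.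
have sum_const n (a : R) : (v n <= n)%N -> \sum_(n - v n <= i < n) a = (v n)%:R * a.
  by move=> vn; rewrite big_const_nat subKn // iter_addr addr0 mulr_natl.
have v_cvg' : (fun n => (v n)%:R / Num.sqrt (n - v n)%:R : R) @ \oo --> x.
  have h0 : (fun n => (v n)%:R / Num.sqrt n%:R *
      (Num.sqrt (n - v n)%:R / Num.sqrt n%:R)^-1 : R) @ \oo --> x * 1^-1.
    apply: cvgM; first exact: v_cvg.
    by apply: cvgV; [exact: oner_neq0|exact: cvg_sqrt_sub].
  rewrite invr1 mulr1 in h0; apply: near_cvg h0; near=> n.
  have n0 : Num.sqrt n%:R != 0 :> R.
    by rewrite gt_eqF // sqrtr_gt0 ltr0n; near: n; exact: nbhs_infty_gt.
  by rewrite invfM invrK -mulrA (mulrCA _^-1) mulVf // mulr1.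
have s_x : s @ \oo --> x.
  apply: (squeeze_cvgr _ v_cvg v_cvg'); near=> n.
  have vn : (v n <= n)%N by near: n.
  have m0 : (0 < n - v n)%N.
    by near: n; exact: near_sub_gt.
  rewrite -!sum_const // /s; apply/andP; split; apply: ler_sum_nat => i /andP[mi i_n].
    rewrite lef_pV2 ?posrE ?sqrtr_gt0 ?ltr0n ?(leq_trans m0) //; last by lia.
    by rewrite ler_wsqrtr // ler_nat ltnW.
  rewrite lef_pV2 ?posrE ?sqrtr_gt0 ?ltr0n ?(leq_trans m0) //.
  by rewrite ler_wsqrtr // ler_nat.
have h0 : (fun n => \sum_(n - v n <= i < n) d i - c * s n) @ \oo --> (0 : R).
  apply/cvgrPdist_le => e e0.
  (* Eventually [s n <= |x| + 1], so an error of [b / sqrt i] in each term adds up to at most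
     [e]. *)
  pose b := e / (`|x| + 1).
  have b0 : 0 < b by rewrite divr_gt0 // ltr_pwDr.
  have [N _ dN] : \forall i \near \oo, `|c - Num.sqrt i%:R * d i| <= b.
    by move/cvgrPdist_le : d_c; apply.
  near=> n.
  have m0 : (N < n - v n)%N.
    by near: n; exact: near_sub_gt.
  rewrite sub0r normrN /s mulr_sumr -sumrB; apply: le_trans (ler_norm_sum _ _ _) _.
  apply: (@le_trans _ _ (b * s n)).
    rewrite /s mulr_sumr; apply: ler_sum_nat => i /andP[mi i_n].
    have i0 : 0 < Num.sqrt i%:R :> R by rewrite sqrtr_gt0 ltr0n; lia.
    have {1}-> : d i = (Num.sqrt i%:R * d i) * (Num.sqrt i%:R)^-1.
      by rewrite mulrAC divff ?mul1r // gt_eqF.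
    rewrite -mulrBl normrM [`|_^-1|]ger0_norm ?invr_ge0 ?sqrtr_ge0 //.
    rewrite ler_wpM2r ?invr_ge0 ?sqrtr_ge0 // distrC; apply: dN => /=; lia.
  have sn : s n <= `|x| + 1.
    have : s n <= x + 1 by near: n; apply: (cvgr_le x) s_x _ _; rewrite ltrDl.
    by have := ler_norm x; lra.
  by rewrite /b mulrAC ler_pdivrMr ?ltr_pwDr // ler_pM2l.
have h1 : (fun n => (\sum_(n - v n <= i < n) d i - c * s n) + c * s n) @ \oo --> 0 + c * x.
  by apply: cvgD h0 _; apply: cvgM; [exact: cvg_cst|exact: s_x].
by rewrite add0r in h1; apply: near_cvg h1; apply: nearW => n; rewrite subrK.
Unshelve. all: by end_near. Qed.

End SqrtIncrement.

(** * Asymptotics of weighted sums of a monotone sequence *)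

Section WeightedSums.
Variables (R : realType) (p : nat -> R).

Definition psum n : R := \sum_(0 <= i < n.+1) p i.
(** Exchanging the sums gives [\sum_v v p(n - v)]; this form makes the increments equal to
    [psum n]. *)
Definition qsum n : R := \sum_(0 <= i < n) psum i.

(** The guard discards the indices at which truncated subtraction would return [p 0]. *)
Definition lsum j n : R :=
  \sum_(0 <= k < n.+1) (if (j * k <= n)%N then p (n - j * k) else 0).
Definition tsum j K n : R :=
  \sum_(1 <= k < K.+1) (if (j * k <= n)%N then k%:R * p (n - j * k) else 0).
Definition wsum j n : R := tsum j n n.

Lemma sum_mul_leq (F : nat -> R) j n a N : (0 < j)%N -> (a <= n.+1)%N -> (n < N)%N ->
  \sum_(a <= k < N) (if (j * k <= n)%N then F k else 0) =
  \sum_(a <= k < n.+1) (if (j * k <= n)%N then F k else 0).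
Proof.
move=> j0 an nN; rewrite (big_cat_nat an nN) /= -[RHS]addr0; congr (_ + _).
rewrite big_nat big1 // => k /andP[nk _]; rewrite ifF //; apply/negbTE.
by rewrite -ltnNge (leq_trans nk) // leq_pmull.
Qed.

Lemma lsum0 j n : (n < j)%N -> lsum j n = p n.
Proof.
move=> nj; rewrite /lsum big_ltn // muln0 subn0 leq0n -[RHS]addr0; congr (_ + _).
rewrite big_nat big1 // => k /andP[k0 _]; rewrite ifF //; apply/negbTE.
by rewrite -ltnNge (leq_trans nj) // leq_pmulr.
Qed.

Lemma wsum0 j n : (n < j)%N -> wsum j n = 0.
Proof.
move=> nj; rewrite /wsum /tsum big_nat big1 //.
by move=> k /andP[k0 _]; rewrite ifF //; apply/negbTE; rewrite -ltnNge (leq_trans nj) // leq_pmulr.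
Qed.

Lemma lsumD j m : (0 < j)%N -> lsum j (m + j) = p (m + j) + lsum j m.
Proof.
move=> j0; rewrite /lsum big_ltn // muln0 subn0 leq0n; congr (_ + _).
rewrite -(@sum_mul_leq _ j m 0 (m + j)) //; last by lia.
rewrite big_add1 /=; apply: eq_bigr => k _.
by rewrite mulnS [(m + j)%N]addnC leq_add2l subnDl.
Qed.

(** Write the indices beyond [K] as [K + i]: the weight [i] gives [wsum j m], and the constant
    weight [K] gives [lsum j m] without its term [i = 0]. *)
Lemma wsum_split j m K : (0 < j)%N ->
  wsum j (m + j * K) = tsum j K (m + j * K) + wsum j m + K%:R * (lsum j m - p m).
Proof.
move=> j0; rewrite /wsum /tsum.
have leK : (K <= m + j * K)%N by rewrite (leq_trans (leq_pmull K j0)) // leq_addl.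
rewrite [LHS](@big_cat_nat _ _ _ K.+1 1)//= -addrA; congr (_ + _).
rewrite -[K.+1]add1n big_addn.
have -> : lsum j m - p m =
    \sum_(1 <= k < m.+1) (if (j * k <= m)%N then p (m - j * k) else 0).
  by rewrite /lsum big_ltn // muln0 subn0 leq0n addrC addKr.
have le1 : (m < (m + j * K).+1 - K)%N.
  by have := leq_pmull K j0; lia.
rewrite -!(@sum_mul_leq _ j m 1 ((m + j * K).+1 - K)) // mulr_sumr -big_split /=.
apply: eq_bigr => i _; rewrite mulnDr leq_add2r subnDr.
by case: ifP => _; rewrite ?mulr0 ?addr0 // natrD mulrDl.
Qed.

Lemma wsumD j m : (0 < j)%N -> wsum j (m + j) = wsum j m + lsum j m.
Proof.
move=> j0; have := @wsum_split j m 1 j0; rewrite muln1 => ->.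
by rewrite /tsum big_nat1 muln1 leq_addl addnK !mul1r; lra.
Qed.

Lemma psumS n : psum n.+1 = psum n + p n.+1.
Proof. by rewrite /psum big_nat_recr. Qed.

Lemma qsumS n : qsum n.+1 = qsum n + psum n.
Proof. by rewrite /qsum big_nat_recr. Qed.

Hypothesis p_gt0 : forall n, 0 < p n.
Hypothesis p_nd : forall n, p n <= p n.+1.

Lemma p_homo m n : (m <= n)%N -> p m <= p n.
Proof. by have /nondecreasing_seqP := p_nd; apply. Qed.

Lemma p_le_psum n : p n <= psum n.
Proof. by rewrite /psum big_nat_recr //= lerDr sumr_ge0 // => i _; exact: ltW. Qed.

Lemma psum_gt0 n : 0 < psum n.
Proof. exact: lt_le_trans (p_gt0 n) (p_le_psum n). Qed.

Lemma psum_geD m i : psum m + i%:R * p m <= psum (m + i).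
Proof.
elim: i => [|i IH]; first by rewrite addn0 mul0r addr0.
by rewrite addnS psumS -natr1; have := @p_homo m (m + i).+1 ltac:(lia); lra.
Qed.

Lemma psum_leD m i : psum (m + i) <= psum m + i%:R * p (m + i).
Proof.
elim: i => [|i IH]; first by rewrite addn0 mul0r addr0.
rewrite addnS psumS -natr1; have := p_nd (m + i); have : 0 <= i%:R :> R by [].
by nra.
Qed.

Lemma psum_le_mul n : psum n <= n.+1%:R * p n.
Proof.
have := psum_leD 0 n; rewrite add0n {2}/psum big_nat1 -natr1.
by have := @p_homo 0 n (leq0n _); lra.
Qed.

Lemma psum_homo m n : (m <= n)%N -> psum m <= psum n.
Proof.
by move/subnKC <-; apply: le_trans (psum_geD _ _); rewrite lerDl mulr_ge0 // ltW.
Qed.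

Lemma qsum_geD m i :
  qsum m + i%:R * psum m + i%:R * (i%:R - 1) / 2 * p m <= qsum (m + i).
Proof.
elim: i => [|i IH]; first by rewrite addn0 !mul0r !addr0.
by rewrite addnS qsumS -natr1; have := psum_geD m i; lra.
Qed.

Lemma qsum_leD m i : qsum (m + i.+1) <= qsum m + i.+1%:R * psum (m + i).
Proof.
elim: i => [|i IH]; first by rewrite addn1 qsumS addn0 mul1r.
rewrite addnS qsumS -[i.+2%:R]natr1.
have := @psum_homo (m + i) (m + i.+1) ltac:(lia); have : 0 <= i.+1%:R :> R by [].
by nra.
Qed.

Lemma qsum_ge0 n : 0 <= qsum n.
Proof. by apply: sumr_ge0 => i _; rewrite ltW // psum_gt0. Qed.

Lemma qsum_gt0 n : (0 < n)%N -> 0 < qsum n.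
Proof.
by case: n => // n _; rewrite qsumS ltr_wpDl ?qsum_ge0 ?psum_gt0.
Qed.

Lemma qsum_le_mul n : qsum n <= n%:R * psum n.
Proof.
case: n => [|n]; first by rewrite /qsum big_geq // mul0r.
have := qsum_leD 0 n; rewrite !add0n {2}/qsum big_geq // add0r => /le_trans; apply.
by rewrite ler_wpM2l ?psum_homo.
Qed.

Lemma step_ind j : (0 < j)%N -> forall Q : nat -> Prop,
  (forall n, (n < j)%N -> Q n) -> (forall m, Q m -> Q (m + j)%N) -> forall n, Q n.
Proof.
move=> j0 Q Qlt QD; elim/ltn_ind => n IH; case: (ltnP n j) => [/Qlt //|jn].
by rewrite -(subnK jn); apply/QD/IH; lia.
Qed.

(** Each sampled value dominates the [j] values of the block ending at it. *)
Lemma psum_le_lsum j m : (0 < j)%N -> psum m <= j%:R * lsum j m.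
Proof.
move=> j0; elim/(step_ind j0) : m => [m mj|m IH].
  rewrite lsum0 //; apply: le_trans (psum_le_mul m) _.
  by rewrite ler_wpM2r ?ler_nat // ltW.
by rewrite lsumD // mulrDr; have := psum_leD m j; lra.
Qed.

(** Each sampled value is dominated by the block of [j] values starting at it; the block at [m]
    overshoots, whence the correction by [j - 1] copies of [p m]. *)
Lemma lsum_le_psum j m : (0 < j)%N -> j%:R * lsum j m <= psum m + (j%:R - 1) * p m.
Proof.
move=> j0; elim/(step_ind j0) : m => [m mj|m IH].
  by rewrite lsum0 //; have := p_le_psum m; lra.
rewrite lsumD // mulrDr; case: j j0 IH => // j _ IH.
by have := psum_geD m j; move: IH; rewrite addnS psumS -natr1; lra.
Qed.

(** In a step of [j] both quantities grow by about [j * psum m], and the discrepancy is at most [j]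
    times the growth of [psum]. *)
Lemma qsum_wsum_dist j n : (0 < j)%N ->
  `|qsum n - j%:R ^+ 2 * wsum j n| <= j%:R * psum n.
Proof.
move=> j0; elim/(step_ind j0) : n => [n nj|m IH].
  rewrite wsum0 // mulr0 subr0 ger0_norm ?qsum_ge0 //.
  apply: le_trans (qsum_le_mul n) _.
  by rewrite ler_pM2r ?psum_gt0 // ler_nat ltnW.
rewrite wsumD // mulrDr expr2.
have := psum_le_lsum m j0; have := lsum_le_psum m j0.
case: j j0 IH => // j _ IH; move: IH; rewrite !ler_norml expr2.
have := qsum_geD m j.+1; have := qsum_leD m j; have := psum_geD m j.
have := @psum_homo (m + j) (m + j.+1) ltac:(lia).
have := p_gt0 m; have : 1 <= j.+1%:R :> R by rewrite ler1n.
have -> : j%:R = j.+1%:R - 1 :> R by rewrite -natr1 addrK.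
move: (lsum _ _) (wsum _ _) (qsum m) (qsum _) (psum m) (psum (m + j)).
move: (psum (m + j.+1)) (p m) (j.+1%:R) => P2 pm J.
move=> l w q q' P P1 J1 pm0 PP1 P1_ge q'_le q'_ge IH l_le l_ge.
have h1 : 0 <= J * (P + (J - 1) * pm - J * l) by apply: mulr_ge0; lra.
have h2 : 0 <= J * (J * l - P) by apply: mulr_ge0; lra.
have h3 : 0 <= J * (P1 - (P + (J - 1) * pm)) by apply: mulr_ge0; lra.
have h4 : 0 <= J * (P2 - P1) by apply: mulr_ge0; lra.
have h5 : 0 <= J * (J - 1) * pm by rewrite !mulr_ge0; lra.
by move: IH => /andP[]; lra.
Qed.

(** Cruder than [qsum_wsum_dist], but uniform in [j] and [n]: it supplies the summable majorant for
    dominated convergence. *)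
Lemma wsum_le_qsum j n : (0 < j)%N -> j%:R ^+ 2 * wsum j n <= 2 * qsum n.
Proof.
move=> j0; elim/(step_ind j0) : n => [n nj|m IH].
  by rewrite wsum0 // mulr0 mulr_ge0 ?qsum_ge0.
rewrite wsumD // mulrDr; have := lsum_le_psum m j0.
have := qsum_geD m j; have := p_le_psum m; have := p_gt0 m.
have J1 : 1 <= j%:R :> R by rewrite ler1n.
move=> pm0 pP q_ge l_le.
have : 0 <= j%:R * (psum m + (j%:R - 1) * p m - j%:R * lsum j m).
  by apply: mulr_ge0; lra.
have : 0 <= j%:R * (psum m - p m) by apply: mulr_ge0; lra.
by nra.
Qed.

Lemma tsum_le_wsum j K n : (0 < j)%N -> tsum j K n <= wsum j n.
Proof.
move=> j0; rewrite /wsum; have [le_Kn|lt_nK] := leqP K n; last first.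
  by rewrite /tsum sum_mul_leq // ltnS ltnW.
rewrite /tsum [leRHS](@big_cat_nat _ _ _ K.+1 1) //= lerDl sumr_ge0 // => k _.
by case: ifP => // _; rewrite mulr_ge0 // ltW.
Qed.

Lemma tsum_ge0 j K n : 0 <= tsum j K n.
Proof. by apply: sumr_ge0 => k _; case: ifP => // _; rewrite mulr_ge0 // ltW. Qed.

Variable L : R.
Hypothesis L_gt0 : 0 < L.
Hypothesis zeta2_L : series (fun j => (j.+1%:R ^+ 2)^-1) @ \oo --> L.
(** For partition numbers this is [mul_npartitions]. *)
Hypothesis p_rec : forall n, n%:R * p n = \sum_(0 <= j < n) wsum j.+1 n.

Local Notation V := (fun n => qsum n.+1 / psum n).
Local Notation kappa := (fun n => p n / qsum n).
Local Notation c := (Num.sqrt L).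

Let V_ge1 n : 1 <= V n.
Proof. by rewrite ler_pdivlMr ?psum_gt0 // mul1r qsumS lerDr qsum_ge0. Qed.

Let kappa_ge0 n : 0 <= kappa n.
Proof. by rewrite divr_ge0 ?qsum_ge0 // ltW. Qed.

Let V_rec n : V n.+1 = 1 + V n / (1 + kappa n.+1 * V n).
Proof.
rewrite /= [qsum n.+2]qsumS psumS.
have := psum_gt0 n; have := qsum_gt0 (ltn0Sn n); have := p_gt0 n.+1.
move: (qsum _) (psum _) (p _) => q P pn pn0 q0 P0.
by field; rewrite !gt_eqF //; lra.
Qed.

Let wsum_dom n j : `|wsum j.+1 n / qsum n| <= 2 * (j.+1%:R ^+ 2)^-1.
Proof.
rewrite ger0_norm ?divr_ge0 ?qsum_ge0 ?tsum_ge0 //.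
have [->|n0] := posnP n.
  by rewrite /qsum big_geq // invr0 mulr0 mulr_ge0 // invr_ge0 sqr_ge0.
by rewrite ler_pdivrMr ?qsum_gt0 // mulrAC ler_pdivlMr ?exprn_gt0 // mulrC wsum_le_qsum.
Qed.

Let dom_cvg : cvgn (series (fun j => 2 * (j.+1%:R ^+ 2)^-1 : R)).
Proof.
have -> : series (fun j => 2 * (j.+1%:R ^+ 2)^-1 : R) =
          (fun n => 2 * series (fun j => (j.+1%:R ^+ 2)^-1) n).
  by apply/funext => n; rewrite /series /= mulr_sumr.
apply/cvg_ex; exists (2 * L); apply: cvgM; [exact: cvg_cst|exact: zeta2_L].
Qed.

(** A bootstrap: this bound, twice the true limit, already forces [V] to infinity through
    [riccati_ge]; hence [psum / qsum] tends to [0], each [wsum j / qsum] converges, and [cvg_kappa]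
    finds the exact limit. *)
Let kappa_le : \forall n \near \oo, n%:R * kappa n <= ((Num.sqrt (2 * L))^-1 ^+ 2)^-1.
Proof.
rewrite exprVn invrK sqr_sqrtr ?mulr_ge0 // ?ltW //.
near=> n; have n0 : (0 < n)%N by near: n; exact: nbhs_infty_gt.
rewrite mulrA p_rec mulr_suml.
apply: (@le_trans _ _ (\sum_(0 <= j < n) 2 * (j.+1%:R ^+ 2)^-1)).
  by apply: ler_sum => j _; apply: le_trans (ler_norm _) (wsum_dom _ _).
rewrite -mulr_sumr ler_pM2l //.
have nd : nondecreasing_seq (series (fun j => (j.+1%:R ^+ 2)^-1 : R)).
  by apply/nondecreasing_seqP => i; rewrite seriesSr lerDl invr_ge0 sqr_ge0.
have := nondecreasing_cvgn_le nd _ n; rewrite (cvg_lim _ zeta2_L) //; apply.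
exact: zeta2_L.
Unshelve. all: by end_near. Qed.

Let psum_qsumE n : (0 < n)%N -> psum n / qsum n = (V n - 1)^-1.
Proof.
move=> n0; rewrite /= qsumS; have := psum_gt0 n; have := qsum_gt0 n0.
move: (qsum _) (psum _) => q P q0 P0.
by field; rewrite !gt_eqF //=; lra.
Qed.

Let psum_qsum0 : (fun n => psum n / qsum n) @ \oo --> (0 : R).
Proof.
have s0 : 0 < (Num.sqrt (2 * L))^-1 by rewrite invr_gt0 sqrtr_gt0 mulr_gt0.
have [B geV] := riccati_ge s0 V_ge1 kappa_ge0 V_rec kappa_le.
set s := (Num.sqrt _)^-1 in s0 geV.
apply/cvgrPdist_le => e e0; near=> n.
have n0 : (0 < n)%N by near: n; exact: nbhs_infty_gt.
rewrite sub0r normrN psum_qsumE //.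
have h1 : (1 + e^-1 + B) / s <= Num.sqrt n%:R by near: n; exact: near_sqrt_ge.
have h2 : s * Num.sqrt n%:R - B <= V n by near: n.
rewrite ler_pdivrMr // in h1.
have h3 : e^-1 <= V n - 1 by lra.
have e0' : 0 < e^-1 by rewrite invr_gt0.
rewrite ger0_norm ?invr_ge0; last by lra.
by rewrite -[leRHS]invrK lef_pV2 // posrE; lra.
Unshelve. all: by end_near. Qed.

Lemma cvg_wsum j : (0 < j)%N -> (fun n => wsum j n / qsum n) @ \oo --> ((j%:R ^+ 2)^-1 : R).
Proof.
move=> j0; have J0 : 0 < j%:R :> R by rewrite ltr0n.
apply/cvgrPdist_le => e e0; near=> n.
have n0 : (0 < n)%N by near: n; exact: nbhs_infty_gt.
have h : `|0 - psum n / qsum n| <= e by near: n; move/cvgrPdist_le : psum_qsum0; apply.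
have q0 := qsum_gt0 n0.
rewrite sub0r normrN ger0_norm ?divr_ge0 ?qsum_ge0 ?(ltW (psum_gt0 _)) // in h.
rewrite ler_pdivrMr // in h.
have := qsum_wsum_dist n j0.
have -> : (j%:R ^+ 2)^-1 - wsum j n / qsum n =
    (qsum n - j%:R ^+ 2 * wsum j n) / (j%:R ^+ 2 * qsum n).
  by field; rewrite !gt_eqF.
rewrite normf_div [`|_ * qsum n|]gtr0_norm ?mulr_gt0 ?exprn_gt0 // => /le_trans h1.
rewrite ler_pdivrMr ?mulr_gt0 ?exprn_gt0 //; apply: h1.
have J1 : 1 <= j%:R :> R by rewrite ler1n.
have h2 : j%:R * psum n <= j%:R * (e * qsum n) by rewrite ler_pM2l.
apply: le_trans h2 _; rewrite expr2.
have : 0 <= (e * qsum n) * (j%:R * (j%:R - 1)) by rewrite !mulr_ge0 ?qsum_ge0 ?(ltW e0) //; lra.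
by lra.
Unshelve. all: by end_near. Qed.

(** Divide [p_rec] by [qsum n] and pass to the limit termwise. *)
Lemma cvg_kappa : (fun n => n%:R * (p n / qsum n)) @ \oo --> L.
Proof.
have h := @cvg_tannery R (fun n j => wsum j.+1 n / qsum n) (fun j => (j.+1%:R ^+ 2)^-1)
  (fun j => 2 * (j.+1%:R ^+ 2)^-1) (fun j => cvg_wsum (ltn0Sn j)) wsum_dom dom_cvg.
rewrite (cvg_lim _ zeta2_L) // in h.
by apply: near_cvg h; apply: nearW => n; rewrite mulrA p_rec mulr_suml.
Qed.

Let c_gt0 : 0 < c. Proof. by rewrite sqrtr_gt0. Qed.

Let cvg_V : (fun n => V n / Num.sqrt n%:R) @ \oo --> c^-1.
Proof. exact: riccati_cvg L_gt0 V_ge1 kappa_ge0 V_rec cvg_kappa. Qed.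

Let cvg_invV : (fun n => Num.sqrt n%:R * (V n)^-1) @ \oo --> c.
Proof.
have h : (fun n => (V n / Num.sqrt n%:R)^-1) @ \oo --> c^-1^-1.
  by apply: cvgV cvg_V; rewrite invr_eq0 gt_eqF.
rewrite invrK in h; apply: near_cvg h; apply: nearW => n.
by rewrite [RHS]invfM invrK mulrC.
Qed.

Lemma cvg_psum : (fun n => Num.sqrt n%:R * (psum n / qsum n)) @ \oo --> c.
Proof.
have h : (fun n => (V n / Num.sqrt n%:R - (Num.sqrt n%:R)^-1)^-1) @ \oo --> (c^-1 - 0)^-1.
  apply: cvgV; first by rewrite subr0 invr_eq0 gt_eqF.
  by apply: cvgB; [exact: cvg_V|exact: cvg_inv_sqrt].
rewrite subr0 invrK in h; apply: near_cvg h; near=> n.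
have n0 : (0 < n)%N by near: n; exact: nbhs_infty_gt.
have r0 : Num.sqrt n%:R != 0 :> R by rewrite gt_eqF // sqrtr_gt0 ltr0n.
rewrite psum_qsumE // -[X in _ = (_ - X)^-1]mul1r -mulrBl invfM invrK mulrC //.
Unshelve. all: by end_near. Qed.

Lemma cvg_p : (fun n => Num.sqrt n%:R * (p n / qsum n)) @ \oo --> (0 : R).
Proof.
have h : (fun n => n%:R * (p n / qsum n) * (Num.sqrt n%:R)^-1) @ \oo --> L * 0.
  by apply: cvgM; [exact: cvg_kappa|exact: cvg_inv_sqrt].
rewrite mulr0 in h; apply: near_cvg h; near=> n.
have r0 : Num.sqrt n%:R != 0 :> R.
  by rewrite gt_eqF // sqrtr_gt0 ltr0n; near: n; exact: nbhs_infty_gt.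
have {2}-> : n%:R = Num.sqrt n%:R * Num.sqrt n%:R :> R by rewrite -expr2 sqr_sqrtr.
by rewrite mulrAC mulfK.
Unshelve. all: by end_near. Qed.

Lemma cvg_lsum j : (0 < j)%N ->
  (fun n => Num.sqrt n%:R * (lsum j n / qsum n)) @ \oo --> c / j%:R.
Proof.
move=> j0; have J0 : 0 < j%:R :> R by rewrite ltr0n.
have h1 : (fun n => Num.sqrt n%:R * (psum n / qsum n) / j%:R) @ \oo --> c / j%:R.
  by apply: cvgM; [exact: cvg_psum|exact: cvg_cst].
have h2 : (fun n => (Num.sqrt n%:R * (psum n / qsum n) +
    (j%:R - 1) * (Num.sqrt n%:R * (p n / qsum n))) / j%:R) @ \oo --> (c + (j%:R - 1) * 0) / j%:R.
  apply: cvgM; last exact: cvg_cst.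
  by apply: cvgD; [exact: cvg_psum|apply: cvgM; [exact: cvg_cst|exact: cvg_p]].
rewrite mulr0 addr0 in h2; apply: (squeeze_cvgr _ h1 h2); apply: nearW => n.
have rq0 : 0 <= Num.sqrt n%:R / qsum n by rewrite divr_ge0 ?sqrtr_ge0 ?qsum_ge0.
have := ler_wpM2l rq0 (psum_le_lsum n j0); have := ler_wpM2l rq0 (lsum_le_psum n j0).
by rewrite ler_pdivrMr // ler_pdivlMr // => l1 l2; apply/andP; split; lra.
Qed.

(** Applying [ln t <= t - 1] to the ratio of consecutive values and to its inverse squeezes the
    increment between [psum n / qsum n.+1] and [psum n / qsum n]. *)
Let cvg_log_ratio : (fun n => Num.sqrt n%:R * (ln (qsum n.+1) - ln (qsum n))) @ \oo --> c.
Proof.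
apply: (squeeze_cvgr _ cvg_invV cvg_psum); near=> n.
have n0 : (0 < n)%N by near: n; exact: nbhs_infty_gt.
have q0 := qsum_gt0 n0; have q1 := qsum_gt0 (ltn0Sn n); have P0 := psum_gt0 n.
have r0 := sqrtr_ge0 (n%:R : R).
have ln_le (x y : R) : 0 < x -> 0 < y -> ln x - ln y <= x / y - 1.
  move=> x0 y0; rewrite -ln_div ?posrE //.
  have xy0 : 0 < x / y by rewrite divr_gt0.
  by have := @le_ln1Dx R (x / y - 1); rewrite [1 + _]addrC subrK; apply; lra.
have h1 := ln_le _ _ q1 q0; have h2 := ln_le _ _ q0 q1.
apply/andP; split; apply: ler_wpM2l => //.
  rewrite invf_div.
  have E : psum n / qsum n.+1 = 1 - qsum n / qsum n.+1.
    by rewrite qsumS in q1 *; field; rewrite gt_eqF.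
  by rewrite E; lra.
have E : psum n / qsum n = qsum n.+1 / qsum n - 1.
  by rewrite qsumS; field; rewrite gt_eqF.
by rewrite E.
Unshelve. all: by end_near. Qed.

(** The logarithm of the ratio telescopes into a window sum handled by [cvg_sum_sqrt]. *)
Lemma cvg_qsum_ratio (v : nat -> nat) (x : R) :
  (\forall n \near \oo, (v n <= n)%N) ->
  (fun n => (v n)%:R / Num.sqrt n%:R) @ \oo --> x ->
  (fun n => qsum (n - v n) / qsum n) @ \oo --> expR (- (c * x)).
Proof.
move=> v_le v_x.
have h := cvg_sum_sqrt v_le v_x cvg_log_ratio.
have h' : (fun n => expR (- \sum_(n - v n <= i < n) (ln (qsum i.+1) - ln (qsum i))))
    @ \oo --> expR (- (c * x)).
  by apply: continuous_cvg; [exact: continuous_expR|exact: cvgN].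
apply: near_cvg h'; near=> n.
have m0 : (0 < n - v n)%N by near: n; exact: near_sub_gt v_le v_x 0.
have vn : (v n <= n)%N by near: n.
rewrite telescope_sumr ?leq_subr // opprB -ln_div ?posrE ?qsum_gt0 //; last by lia.
by rewrite lnK // posrE divr_gt0 ?qsum_gt0 //; lia.
Unshelve. all: by end_near. Qed.

Section Truncated.
Variables (K : nat -> nat) (x : R).
Hypothesis K_x : (fun n => (K n)%:R / Num.sqrt n%:R) @ \oo --> x.

Lemma cvg_tsum j : (0 < j)%N ->
  (fun n => tsum j (K n) n / qsum n) @ \oo -->
  (1 - (1 + j%:R * (c * x)) * expR (- (j%:R * (c * x)))) / j%:R ^+ 2.
Proof.
move=> j0; have J0 : 0 < j%:R :> R by rewrite ltr0n.
pose v n := (j * K n)%N.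
have v_x : (fun n => (v n)%:R / Num.sqrt n%:R : R) @ \oo --> j%:R * x.
  have h : (fun n => j%:R * ((K n)%:R / Num.sqrt n%:R) : R) @ \oo --> j%:R * x.
    by apply: cvgM; [exact: cvg_cst|exact: K_x].
  by apply: near_cvg h; apply: nearW => n; rewrite natrM mulrA.
have v_le : \forall n \near \oo, (v n <= n)%N.
  have h : \forall n \near \oo, (v n)%:R / Num.sqrt n%:R <= j%:R * x + 1.
    by apply: (cvgr_le (j%:R * x)) v_x _ _; rewrite ltrDl.
  near=> n; rewrite -(ler_nat R).
  have r0 : 0 < Num.sqrt n%:R :> R.
    by rewrite sqrtr_gt0 ltr0n; near: n; exact: nbhs_infty_gt.
  have : (v n)%:R / Num.sqrt n%:R <= j%:R * x + 1 by near: n.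
  rewrite ler_pdivrMr // => /le_trans; apply.
  have {2}-> : n%:R = Num.sqrt n%:R * Num.sqrt n%:R :> R by rewrite -expr2 sqr_sqrtr.
  by rewrite ler_pM2r //; near: n; exact: near_sqrt_ge.
set e := expR _; have E : e = expR (- (c * (j%:R * x))) by rewrite /e mulrCA.
have q_cvg := cvg_qsum_ratio v_le v_x; rewrite -E in q_cvg.
have m_oo := cvg_sub_infty v_le v_x.
have w_cvg := cvg_comp _ _ m_oo (cvg_wsum j0).
have l_cvg := cvg_comp _ _ m_oo (cvg_lsum j0).
have p_cvg := cvg_comp _ _ m_oo cvg_p.
have s_cvg := cvg_sqrt_sub v_le v_x.
(* This is [wsum_split] at [m = n - v n], solved for [tsum] and divided by [qsum n], with each term
   factored into quantities of known limit. *)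
have h : (fun n => wsum j n / qsum n -
    wsum j (n - v n) / qsum (n - v n) * (qsum (n - v n) / qsum n) -
    (K n)%:R / Num.sqrt n%:R * (Num.sqrt (n - v n)%:R / Num.sqrt n%:R)^-1 *
    (Num.sqrt (n - v n)%:R * (lsum j (n - v n) / qsum (n - v n)) -
     Num.sqrt (n - v n)%:R * (p (n - v n) / qsum (n - v n))) *
    (qsum (n - v n) / qsum n)) @ \oo -->
    (j%:R ^+ 2)^-1 - (j%:R ^+ 2)^-1 * e - x * 1^-1 * (c / j%:R - 0) * e.
  apply: cvgB; first apply: cvgB.
  - exact: cvg_wsum.
  - by apply: cvgM; [exact: w_cvg|exact: q_cvg].
  - apply: cvgM; last exact: q_cvg.
    apply: cvgM; last by apply: cvgB; [exact: l_cvg|exact: p_cvg].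
    apply: cvgM; first exact: K_x.
    by apply: cvgV; [exact: oner_neq0|exact: s_cvg].
have {}E : (j%:R ^+ 2)^-1 - (j%:R ^+ 2)^-1 * e - x * 1^-1 * (c / j%:R - 0) * e =
    (1 - (1 + j%:R * (c * x)) * e) / j%:R ^+ 2.
  by field; rewrite gt_eqF.
rewrite {}E in h; apply: near_cvg h; near=> n.
have m0 : (0 < n - v n)%N by near: n; exact: near_sub_gt v_le v_x 0.
have vn : (v n <= n)%N by near: n.
have := wsum_split (n - v n) (K n) j0; rewrite subnK // => ->.
have q0 := qsum_gt0 m0.
have q1 : 0 < qsum n by apply: qsum_gt0; lia.
have r1 : 0 < Num.sqrt n%:R :> R by rewrite sqrtr_gt0 ltr0n; lia.
have r0 : 0 < Num.sqrt (n - v n)%:R :> R by rewrite sqrtr_gt0 ltr0n.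
by field; rewrite !gt_eqF.
Unshelve. all: by end_near. Qed.

Lemma cvg_sum_tsum :
  (fun n => (\sum_(0 <= j < n) tsum j.+1 (K n) n) / (n%:R * p n)) @ \oo -->
  limn (series (fun j =>
    (1 - (1 + j.+1%:R * (c * x)) * expR (- (j.+1%:R * (c * x)))) / j.+1%:R ^+ 2)) / L.
Proof.
have dom n j : `|tsum j.+1 (K n) n / qsum n| <= 2 * (j.+1%:R ^+ 2)^-1.
  apply: le_trans (wsum_dom n j).
  rewrite !ger0_norm ?divr_ge0 ?qsum_ge0 ?tsum_ge0 // ler_wpM2r ?invr_ge0 ?qsum_ge0 //.
  exact: tsum_le_wsum.
have h := @cvg_tannery R (fun n j => tsum j.+1 (K n) n / qsum n) _
  (fun j => 2 * (j.+1%:R ^+ 2)^-1) (fun j => cvg_tsum (ltn0Sn j)) dom dom_cvg.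
have h2 : (fun n => (n%:R * (p n / qsum n))^-1) @ \oo --> L^-1.
  by apply: cvgV; [rewrite gt_eqF|exact: cvg_kappa].
have h3 : (fun n => (\sum_(0 <= j < n) tsum j.+1 (K n) n / qsum n) *
    (n%:R * (p n / qsum n))^-1) @ \oo -->
    limn (series (fun j => (1 - (1 + j.+1%:R * (c * x)) *
      expR (- (j.+1%:R * (c * x)))) / j.+1%:R ^+ 2)) / L.
  by apply: cvgM; [exact: h|exact: h2].
apply: near_cvg h3; near=> n.
have n0 : (0 < n)%N by near: n; exact: nbhs_infty_gt.
rewrite -mulr_suml; have q0 := qsum_gt0 n0; have pn0 := p_gt0 n.
have n0' : 0 < n%:R :> R by rewrite ltr0n.
by field; rewrite !gt_eqF.
Unshelve. all: by end_near. Qed.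

End Truncated.
End WeightedSums.

(** * The value [pi ^+ 2 / 6] of the sum of inverse squares *)

Lemma le_of_is_derive (R : realType) (f f' : R -> R) (b x : R) :
  (forall x : R, is_derive x (1 : R) f (f' x)) -> (forall x, 0 < x < b -> 0 <= f' x) ->
  0 <= x <= b -> f 0 <= f x.
Proof.
move=> df f'0 /andP[x0 xb].
have dfx y : derivable f y 1 by have := df y; case.
apply: (@ger0_derive1_ndecr _ f 0 b) => // [y|].
  by rewrite in_itv /= => y0b; rewrite derive1E (@derive_val _ _ _ _ _ _ _ (df y)) f'0.
by apply: derivable_within_continuous => y _; exact: dfx.
Qed.

Lemma sin_le_id (R : realType) (x : R) : 0 <= x -> sin x <= x.
Proof.
move=> x0; rewrite -subr_ge0.
have := @le_of_is_derive R (fun x => x - sin x) (fun x => 1 - cos x) x x.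
rewrite /= sin0 subr0; apply.
- by move=> y _; rewrite subr_ge0 cos_le1.
- by rewrite x0 lexx.
Qed.

Lemma mul_cos_le_sin (R : realType) (x : R) : 0 <= x <= pi / 2 -> x * cos x <= sin x.
Proof.
move=> x0; rewrite -subr_ge0.
have := @le_of_is_derive R (fun x => sin x - x * cos x) (fun x => x * sin x) (pi / 2) x.
rewrite /= sin0 mul0r subr0; apply => //.
- move=> y.
  have := is_deriveB (is_derive_sin y)
    (is_deriveM (is_derive_id y (1 : R)) (is_derive_cos y)).
  by move/is_derive_eq; apply; rewrite /GRing.scale /=; ring.
- move=> y y0; rewrite mulr_ge0 ?(ltW (sin_gt0_pihalf y0)) //.
  by case/andP: y0 => /ltW.
Qed.

(** After clearing denominators the upper bound reads [(x cos x)^2 <= (sin x)^2]. *)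
Lemma inv_sqr_bounds (R : realType) (x : R) : 0 < x < pi / 2 ->
  (x ^+ 2)^-1 <= (sin x ^+ 2)^-1 <= (x ^+ 2)^-1 + 1.
Proof.
move=> x0b; have /andP[x0 xb] := x0b.
have s0 := sin_gt0_pihalf x0b; have s_le := sin_le_id (ltW x0).
have c_le : x * cos x <= sin x by apply: mul_cos_le_sin; rewrite !ltW.
have c0 : 0 <= cos x by apply: cos_ge0_pihalf; rewrite (ltW xb) andbT; lra.
have x2 : 0 < x ^+ 2 by rewrite exprn_gt0.
have s2 : 0 < sin x ^+ 2 by rewrite exprn_gt0.
apply/andP; split; first by rewrite lef_pV2 ?posrE // ler_sqr // nnegrE ltW.
rewrite -subr_ge0.
have -> : (x ^+ 2)^-1 + 1 - (sin x ^+ 2)^-1 =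
    (sin x ^+ 2 - (x * cos x) ^+ 2) / (x ^+ 2 * sin x ^+ 2).
  by rewrite exprMn cos2sin2; field; rewrite !gt_eqF.
apply: divr_ge0; last by rewrite ltW // mulr_gt0.
by rewrite subr_ge0 ler_sqr // nnegrE ?(ltW s0) // mulr_ge0 // ltW.
Qed.

(** Approximates [(2 M / pi)^2] times a partial sum of inverse squares, and has a closed form when
    [M] is a power of two. *)
Definition csc_sum (R : realType) (M : nat) : R :=
  \sum_(1 <= k < M) (sin (k%:R * (pi / (2 * M%:R))) ^+ 2)^-1.

Lemma angle_bounds (R : realType) M k : (0 < k < M)%N ->
  0 < k%:R * (pi / (2 * M%:R) : R) < (pi / 2 : R).
Proof.
move=> /andP[k0 kM]; have M0 : 0 < M%:R :> R by rewrite ltr0n; lia.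
rewrite mulr_gt0 ?ltr0n ?divr_gt0 ?pi_gt0 ?mulr_gt0 //=.
have -> : pi / 2 = M%:R * (pi / (2 * M%:R)) :> R by field; rewrite gt_eqF.
by rewrite ltr_pM2r ?ltr_nat // divr_gt0 ?pi_gt0 // mulr_gt0.
Qed.

(* Pair k with 2 M - k and use 1 / sin^2 a + 1 / cos^2 a = 4 / sin^2 (2 a). *)
Lemma csc_sum_double (R : realType) M : (0 < M)%N ->
  csc_sum R (2 * M) = 4 * csc_sum R M + 2.
Proof.
move=> M0; rewrite /csc_sum; set x : R := pi / (2 * (2 * M)%:R).
have M0' : 0 < M%:R :> R by rewrite ltr0n.
have xE : pi / (2 * M%:R) = 2 * x :> R by rewrite /x natrM; field; rewrite gt_eqF.
rewrite xE.
have sinB k : (k <= 2 * M)%N -> sin ((2 * M - k)%:R * x) = cos (k%:R * x).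
  move=> kM; have -> : (2 * M - k)%:R * x = pi / 2 - k%:R * x.
    by rewrite natrB // /x natrM; field; rewrite gt_eqF.
  by rewrite sinB sin_pihalf cos_pihalf mul1r mul0r subr0.
(* The middle angle is [pi / 4], where sine and cosine agree. *)
have mid : (sin (M%:R * x) ^+ 2)^-1 = 2.
  have := sinB M; rewrite mul2n -addnn addnK leq_addl => /(_ isT) E.
  have := cos2Dsin2 (M%:R * x); rewrite -E => E2.
  have -> : sin (M%:R * x) ^+ 2 = 2^-1 by lra.
  by rewrite invrK.
rewrite (@big_cat_nat _ _ _ M) /=; [|lia..].
rewrite [X in _ + X]big_ltn; last by lia.
rewrite mid addrCA [RHS]addrC; congr (_ + _).
rewrite [X in _ + X]big_nat_rev /= -[M.+1]add1n big_addn.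
have -> : (2 * M - M = M)%N by lia.
rewrite -big_split mulr_sumr /=; apply: eq_big_nat => k /andP[k0 kM].
have -> : (1 + M + 2 * M - (k + M).+1 = 2 * M - k)%N by lia.
rewrite sinB; last by lia.
have := @angle_bounds R (2 * M) k; rewrite -/x => xb.
have xk : 0 < k%:R * x < pi / 2 by apply: xb; lia.
have s0 := sin_gt0_pihalf xk.
have c0 : 0 < cos (k%:R * x).
  by apply: cos_gt0_pihalf; case/andP: xk => h1 h2; rewrite h2 andbT; lra.
have -> : k%:R * (2 * x) = (k%:R * x) *+ 2 by rewrite mulr2n; ring.
rewrite sin_mulr2n.
have E := cos2Dsin2 (k%:R * x).
move: s0 c0 E; move: (sin _) (cos _) => s c s0 c0 E.
have -> : (s ^+ 2)^-1 + (c ^+ 2)^-1 = (c ^+ 2 + s ^+ 2) / (c * s) ^+ 2.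
  by field; rewrite !gt_eqF.
rewrite E; field; rewrite !gt_eqF //.
Qed.

Lemma csc_sum_pow2 (R : realType) m : csc_sum R (2 ^ m) = 2 * ((2 ^ m)%:R ^+ 2 - 1) / 3.
Proof.
elim: m => [|m IH]; first by rewrite /csc_sum expn0 big_geq // expr1n subrr mulr0 mul0r.
by rewrite expnS csc_sum_double ?expn_gt0 // IH natrM; field.
Qed.

Lemma inv_sqr_sum_bounds (R : realType) M : (0 < M)%N ->
  csc_sum R M - M%:R <= (2 * M%:R / pi) ^+ 2 * \sum_(1 <= k < M) (k%:R ^+ 2)^-1 <= csc_sum R M.
Proof.
move=> M0; have M0' : 0 < M%:R :> R by rewrite ltr0n.
have E : (2 * M%:R / pi) ^+ 2 * \sum_(1 <= k < M) (k%:R ^+ 2)^-1 =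
    \sum_(1 <= k < M) ((k%:R * (pi / (2 * M%:R))) ^+ 2)^-1 :> R.
  rewrite mulr_sumr; apply: eq_big_nat => k /andP[k0 _].
  have pi0 := pi_gt0 R; have k0' : 0 < k%:R :> R by rewrite ltr0n.
  by move: (pi : R) pi0 => q q0; field; rewrite !gt_eqF.
rewrite E; apply/andP; split; last first.
  by apply: ler_sum_nat => k /(@angle_bounds R)/inv_sqr_bounds/andP[].
rewrite lerBlDr.
apply: (@le_trans _ _ (\sum_(1 <= k < M) (((k%:R * (pi / (2 * M%:R))) ^+ 2)^-1 + 1))).
  by apply: ler_sum_nat => k /(@angle_bounds R)/inv_sqr_bounds/andP[].
rewrite big_split /= lerD2l sumr_const_nat ler_nat; lia.
Qed.

Lemma cvg_zeta2 (R : realType) :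
  series (fun j => (j.+1%:R ^+ 2)^-1 : R) @ \oo --> (pi ^+ 2 / 6 : R).
Proof.
set u := series _.
have pi0 := pi_gt0 R; have p0 : 0 < pi ^+ 2 :> R by rewrite exprn_gt0.
have uE M : \sum_(1 <= k < M) (k%:R ^+ 2)^-1 = u M.-1 by rewrite big_add1.
have nd : nondecreasing_seq u.
  by apply/nondecreasing_seqP => i; rewrite /u seriesSr lerDl invr_ge0 sqr_ge0.
(* Only powers of two are available here; monotonicity of [u] covers the other indices. The constant
   [3] absorbs the [M - 1] unit errors and the [- 1] of the closed form. *)
have bounds m : pi ^+ 2 / 6 * (1 - 3 / (2 ^ m)%:R) <= u (2 ^ m).-1 <= pi ^+ 2 / 6.
  have M0 : (0 < 2 ^ m)%N by rewrite expn_gt0.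
  have := @inv_sqr_sum_bounds R _ M0; rewrite csc_sum_pow2 uE.
  have M1 : 1 <= (2 ^ m)%:R :> R by rewrite ler1n.
  move: (u _) ((2 ^ m)%:R) M1 => U M M1.
  have M0' : 0 < M by lra.
  have -> : (2 * M / pi) ^+ 2 * U = U * (4 * M ^+ 2 / pi ^+ 2).
    by move: (pi : R) pi0 => q q0; field; rewrite gt_eqF.
  have c0 : 0 < 4 * M ^+ 2 / pi ^+ 2 by rewrite divr_gt0 ?mulr_gt0 ?exprn_gt0.
  move=> /andP[h1 h2]; apply/andP; split; rewrite -(ler_pM2r c0).
    apply: le_trans h1.
    have -> : pi ^+ 2 / 6 * (1 - 3 / M) * (4 * M ^+ 2 / pi ^+ 2) = 2 / 3 * (M ^+ 2 - 3 * M).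
      by move: (pi : R) pi0 => q q0; field; rewrite !gt_eqF.
    by lra.
  apply: le_trans h2 _.
  have -> : pi ^+ 2 / 6 * (4 * M ^+ 2 / pi ^+ 2) = 2 / 3 * M ^+ 2.
    by move: (pi : R) pi0 => q q0; field; rewrite !gt_eqF.
  by lra.
have u_le n : u n <= pi ^+ 2 / 6.
  have /andP[_] := bounds n; apply: le_trans; apply: nd.
  by rewrite -ltnS prednK ?expn_gt0 // ltn_expl.
apply/cvgrPdist_le => e e0.
have [m me] : exists m : nat, pi ^+ 2 / (2 * e) <= m%:R :> R.
  by have [m _ /(_ m (leqnn m))] := @nbhs_infty_ger R (pi ^+ 2 / (2 * e)); exists m.
near=> n; rewrite ger0_norm ?subr_ge0 // lerBlDr -lerBlDl.
have /andP[h1 _] := bounds m.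
apply: (@le_trans _ _ (u (2 ^ m).-1)); last by apply: nd; near: n; exact: nbhs_infty_ge.
apply: le_trans h1; rewrite mulrBr mulr1 lerD2l lerN2.
have M0 : 0 < (2 ^ m)%:R :> R by rewrite ltr0n expn_gt0.
have -> : pi ^+ 2 / 6 * (3 / (2 ^ m)%:R) = pi ^+ 2 / 2 / (2 ^ m)%:R :> R.
  by field; rewrite gt_eqF.
rewrite ler_pdivrMr // -ler_pdivrMl //.
have -> : e^-1 * (pi ^+ 2 / 2) = pi ^+ 2 / (2 * e) by field; rewrite gt_eqF.
by apply: le_trans me _; rewrite ler_nat ltnW // ltn_expl.
Unshelve. all: by end_near. Qed.

(** * The limiting integral as a series *)

Lemma integral_mul_expR (R : realType) (k y : R) : 0 < k -> 0 < y ->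
  (\int[lebesgue_measure]_(u in `[0%R, y]) (u * expR (- (k * u)))%R%:E =
   ((1 - (1 + k * y) * expR (- (k * y))) / k ^+ 2)%R%:E)%E.
Proof.
move=> k0 y0.
pose F (u : R) := - (k ^+ 2)^-1 * ((1 + k * u) * expR (- (k * u))).
have dF u : is_derive u (1 : R) F (u * expR (- (k * u))).
  by apply: is_derive_eq; rewrite /GRing.scale /=; field; rewrite gt_eqF.
have dFu u : derivable F u 1 by have := dF u; case.
have cF u : F @ u --> F u.
  by apply: differentiable_continuous; apply/derivable1_diffP.
have cf : continuous (fun u : R => u * expR (- (k * u))).
  move=> u; apply: differentiable_continuous; apply/derivable1_diffP.
  exact: ex_derive.
rewrite (@continuous_FTC2 _ _ F _ _ y0).
- by rewrite -EFinB /F; congr EFin; rewrite !mulr0 oppr0 expR0; field; rewrite gt_eqF.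
- exact: continuous_subspaceT.
- by split=> //; [apply: cvg_at_right_filter|apply: cvg_at_left_filter]; exact: cF.
- by move=> u _; rewrite derive1E (@derive_val _ _ _ _ _ _ _ (dF u)).
Qed.

Lemma bose_series (R : realType) (u : R) : 0 <= u ->
  series (fun j => u * expR (- (j.+1%:R * u))) @ \oo --> u / (expR u - 1).
Proof.
(* At [u = 0] the quotient is [0 / 0], which is [0] by convention, as is every term of the
   series. *)
rewrite le_eqVlt => /predU1P[<-|u0].
  rewrite mul0r (_ : series _ = cst 0); first exact: cvg_cst.
  by apply/funext => n; rewrite /series /= big1 // => j _; rewrite mul0r.
have z1 : `|expR (- u)| < 1 by rewrite ger0_norm ?expR_ge0 // expR_lt1 oppr_lt0.
have := @cvg_geometric_series R (u * expR (- u)) _ z1.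
have e1 : 1 < expR u by rewrite expR_gt1.
have -> : u * expR (- u) * (1 - expR (- u))^-1 = u / (expR u - 1).
  by rewrite expRN; field; rewrite !gt_eqF ?subr_gt0 ?expR_gt0.
suff -> : (fun j => u * expR (- (j.+1%:R * u))) = geometric (u * expR (- u)) (expR (- u)) by [].
by apply/funext => j; rewrite /geometric /= -mulrA -exprS -expRM_natl mulrN.
Qed.

(** The integral of [u * expR (- (j.+1%:R * u))] over [[0, y]], and also the limit in [cvg_tsum] at
    [j.+1], with [y] for [c * x]. *)
Definition hook_term (R : realType) (y : R) (j : nat) : R :=
  (1 - (1 + j.+1%:R * y) * expR (- (j.+1%:R * y))) / j.+1%:R ^+ 2.

Lemma is_cvg_hook_term (R : realType) (y : R) : 0 < y -> cvgn (series (hook_term y)).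
Proof.
move=> y0; have cz : cvgn (series (fun j => (j.+1%:R ^+ 2)^-1 : R)).
  by apply/cvg_ex; exists (pi ^+ 2 / 6); exact: cvg_zeta2.
have jy j : 0 <= j.+1%:R * y :> R by rewrite mulr_ge0 // ltW.
apply: (series_le_cvg _ _ _ cz) => j; rewrite ?invr_ge0 ?sqr_ge0 //.
  rewrite divr_ge0 ?sqr_ge0 // expRN subr_ge0 ler_pdivrMr ?expR_gt0 // mul1r.
  exact: expR_ge1Dx.
by rewrite -[leRHS]mul1r ler_wpM2r ?invr_ge0 ?sqr_ge0 // gerBl mulr_ge0 ?expR_ge0 ?addr_ge0.
Qed.

(** Expand by [bose_series] and integrate termwise, which nonnegativity allows. *)
Lemma integral_bose (R : realType) (y : R) : 0 < y ->
  \int[lebesgue_measure]_(u in `[0, y]) (u / (expR u - 1)) = limn (series (hook_term y)).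
Proof.
move=> y0; rewrite /Rintegral.
have -> : (\int[lebesgue_measure]_(u in `[0%R, y]) (u / (expR u - 1))%R%:E =
    \int[lebesgue_measure]_(u in `[0%R, y])
      \sum_(0 <= j <oo) (u * expR (- (j.+1%:R * u)))%R%:E)%E.
  apply: eq_integral => u; rewrite inE /= in_itv /= => /andP[u0 _].
  have h := bose_series u0; rewrite -(cvg_lim _ h) //.
  rewrite -EFin_lim; last by apply/cvg_ex; eexists; exact: h.
  by congr (limn _); apply/funext => n; rewrite /= sumEFin.
rewrite integral_nneseries //=.
- rewrite (eq_eseriesr (g := fun j => (hook_term y j)%:E)); last first.
    by move=> j _; rewrite integral_mul_expR.
  rewrite -[RHS]/(fine (limn (series (hook_term y)))%:E) -EFin_lim; last exact: is_cvg_hook_term.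
  by congr (fine (limn _)); apply/funext => n; rewrite /= sumEFin.
- move=> j; apply/measurable_EFinP; apply: measurable_funTS.
  apply: continuous_measurable_fun => u; apply: differentiable_continuous.
  by apply/derivable1_diffP; exact: ex_derive.
- by move=> j u; rewrite /= in_itv /= lee_fin => /andP[u0 _]; rewrite mulr_ge0 ?expR_ge0.
Qed.

(** * Application to partition numbers and the limit law *)

Section PartitionAsymptotics.
Variable R : realType.
Let p (n : nat) : R := (npartitions n)%:R.

Let p_gt0 n : 0 < p n.
Proof. by rewrite ltr0n; apply/card_gt0P; exists (PartitionOf (ones_partition n)). Qed.

Let p_nd n : p n <= p n.+1.
Proof. by rewrite ler_nat leq_npartitions. Qed.

Let sum_tsumE n K :
  (\sum_(1 <= j < n.+1) \sum_(1 <= k < K.+1)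
    (if (j * k <= n)%N then k * npartitions (n - j * k) else 0)%N)%:R =
  \sum_(0 <= j < n) tsum p j.+1 K n :> R.
Proof.
rewrite big_add1 natr_sum; apply: eq_bigr => j _; rewrite natr_sum.
by apply: eq_bigr => k _; case: ifP => // _; rewrite natrM.
Qed.

Let p_rec n : n%:R * p n = \sum_(0 <= j < n) wsum p j.+1 n.
Proof. by rewrite -natrM mul_npartitions sum_tsumE. Qed.

Lemma cvg_Pr_hook (K : nat -> nat) (x : R) :
  (fun n => (K n)%:R / Num.sqrt n%:R) @ \oo --> x ->
  (fun n => Pr R (fun w : Omega n => (Z w <= K n)%N)) @ \oo -->
  limn (series (hook_term (Num.sqrt (pi ^+ 2 / 6) * x))) / (pi ^+ 2 / 6).
Proof.
move=> K_x; have z0 : 0 < pi ^+ 2 / 6 :> R by rewrite divr_gt0 ?exprn_gt0 ?pi_gt0.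
have := cvg_sum_tsum p_gt0 p_nd z0 (@cvg_zeta2 R) p_rec K_x.
apply: near_cvg; apply: nearW => n.
by rewrite Pr_card -sum_tsumE -card_Z_leq natrM.
Qed.

End PartitionAsymptotics.

Theorem theorem1 (R : realType) (y : R) (hy : 0 < y) :
  (fun n : nat =>
     Pr R (fun w : Omega n => pi * (Z w)%:R / Num.sqrt (6 * n%:R) <= y))
    @ \oo -->
  6 / pi ^+ 2 *
    (\int[lebesgue_measure]_(u in `[0, y]) (u / (expR u - 1)) : R).
Proof.
have pi0 := pi_gt0 R.
have s6 : 0 < Num.sqrt 6 :> R by rewrite sqrtr_gt0.
(* The event becomes [Z w <= x * sqrt n], and [c * x = y] for [c = pi / sqrt 6]. *)
pose x : R := y * Num.sqrt 6 / pi.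
have x0 : 0 < x by rewrite !mulr_gt0 ?invr_gt0.
have cx : Num.sqrt (pi ^+ 2 / 6) * x = y.
  rewrite sqrtrM ?sqr_ge0 // sqrtr_sqr gtr0_norm // sqrtrV //.
  by rewrite /x; move: (pi : R) pi0 => q q0; field; rewrite !gt_eqF.
(* Hook lengths are integers, so truncating the threshold leaves the event unchanged. *)
pose K n := Num.truncn (x * Num.sqrt n%:R).
have K_x : (fun n => (K n)%:R / Num.sqrt n%:R : R) @ \oo --> x.
  have h : (fun n => x - (Num.sqrt n%:R)^-1 : R) @ \oo --> x - 0.
    by apply: cvgB; [exact: cvg_cst|exact: cvg_inv_sqrt].
  rewrite subr0 in h; apply: (squeeze_cvgr _ h (cvg_cst x)); near=> n.
  have r0 : 0 < Num.sqrt n%:R :> R.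
    by rewrite sqrtr_gt0 ltr0n; near: n; exact: nbhs_infty_gt.
  have /truncn_itv/andP[h1 h2] : 0 <= x * Num.sqrt n%:R by rewrite mulr_ge0 // ltW.
  rewrite ler_pdivrMr // h1 andbT ler_pdivlMr // mulrBl mulVf ?gt_eqF //.
  by rewrite lerBlDr natr1 ltW.
have := cvg_Pr_hook K_x; rewrite cx (integral_bose hy) mulrC invf_div.
apply: near_cvg; near=> n.
have r0 : 0 < Num.sqrt n%:R :> R.
  by rewrite sqrtr_gt0 ltr0n; near: n; exact: nbhs_infty_gt.
congr (Pr R _); apply/funext => w.
have xr0 : 0 <= x * Num.sqrt n%:R by rewrite mulr_ge0 // ltW.
rewrite truncn_ge_nat //.
rewrite sqrtrM // ler_pdivrMr ?mulr_gt0 // mulrC -ler_pdivlMr //.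
by congr (_ <= _); rewrite /x; ring.
Unshelve. all: by end_near. Qed.
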